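(* Fix $\epsilon>0$. For each $n$ let $\sigma=\sigma_n\in[0,1]$ (possibly depending on $n$) with $\sigma\le n^{-1-\epsilon}$, let $A,B\in\mathbb{R}^{n\times n}$ follow the Gaussian Wigner model with noise parameter $\sigma$ and ground-truth permutation $\pi^\star$, and let $X^\star\in\arg\min_{X\in\mathcal{B}_n}\|AX-XB\|_F^2$. For $i\in[n]$ let $\hat\pi(i)=\arg\max_{j\in[n]}X^\star_{ij}$. Then, for $n$ large enough, with probability $1-o(1)$ as $n\to\infty$, $$\sum_{i=1}^n\mathbf{1}\{\hat\pi(i)\ne\pi^\star(i)\}=o(n),$$ i.e. there is a deterministic sequence $r_n=o(n)$ such that $\mathbb{P}\big(\sum_{i=1}^n\mathbf{1}\{\hat\pi(i)\ne\pi^\star(i)\}\le r_n\big)\to1$.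
   Context: $[n]=\{1,\dots,n\}$ and $\|\cdot\|_F$ is the Frobenius norm. $\mathcal{B}_n$ is the Birkhoff polytope, i.e. the set of $n\times n$ doubly stochastic matrices. A random symmetric matrix $A\in\mathbb{R}^{n\times n}$ is a GOE matrix if $A_{ii}\sim N(0,2/n)$ for all $i$, $A_{ij}=A_{ji}\sim N(0,1/n)$ for all $i\ne j$, and $\{A_{ij}:i\le j\}$ are mutually independent. Matrices $A,B\in\mathbb{R}^{n\times n}$ follow the Gaussian Wigner model with noise parameter $\sigma\ge 0$ and ground-truth permutation $\pi^\star$ of $[n]$ if $B_{\pi^\star(i),\pi^\star(j)}=A_{ij}+\sigma Z_{ij}$ for all $i,j\in[n]$, where $A$ and $Z$ are independent GOE matrices. $X^\star$ denotes an optimal solution of the stated problem, and $\hat\pi(i)$ is any maximizing index (ties broken arbitrarily); $\hat\pi$ need not be a permutation. *)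

(* Defs.v *)
From HB Require Import structures.
From mathcomp Require Import all_boot all_order all_algebra all_fingroup.
From mathcomp Require Import all_classical all_reals all_analysis.

Set Implicit Arguments.
Unset Strict Implicit.
Unset Printing Implicit Defensive.

Import Order.TTheory GRing.Theory Num.Theory.
Import numFieldNormedType.Exports.

Local Open Scope classical_set_scope.
Local Open Scope ring_scope.

Definition frobenius_norm {R : realType} {m n : nat} (M : 'M[R]_(m, n)) : R :=
  Num.sqrt (\sum_i \sum_j M i j ^+ 2).

Definition birkhoff {R : realType} (n : nat) : set 'M[R]_n :=
  [set X | [/\ forall i j, 0 <= X i j,
               forall i, \sum_j X i j = 1 &
               forall j, \sum_i X i j = 1]].
Arguments birkhoff {R} n _.

Definition argmin {R : realType} {V : Type} (S : set V) (f : V -> R) : set V :=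
  [set x | S x /\ forall y, S y -> f x <= f y].

Definition argmax {R : realType} {V : Type} (S : set V) (f : V -> R) : set V :=
  [set x | S x /\ forall y, S y -> f y <= f x].

Section random_matrices.
Context {d : measure_display} {T : measurableType d} {R : realType}.
Variable P : probability T R.

(* The second parameter of normal_prob is the standard deviation, hence the
   square root of the variance v. A measure is only constrained on measurable
   sets, hence the restriction on U. *)
Definition normal_law (X : T -> R) (v : R) : Prop :=
  forall U : set R, measurable U ->
    pushforward P X U = normal_prob 0 (Num.sqrt v) U.

Definition mutually_independent {I : finType} (D : {pred I}) (X : I -> T -> R)
    : Prop :=
  forall J : {set I}, J \subset D ->
  forall U : I -> set R, (forall i, measurable (U i)) ->
    P (\bigcap_(i in [set` J]) (X i @^-1` U i)) =
    (\prod_(i in J) P (X i @^-1` U i))%E.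

(* the sigma-algebra on T generated by the entries of a random matrix *)
Definition sigma_of_mx {m n : nat} (X : T -> 'M[R]_(m, n)) : set (set T) :=
  <<s \bigcup_(ij in [set: 'I_m * 'I_n])
        preimage_set_system setT (fun w => X w ij.1 ij.2) measurable >>.

Definition independent_mx {m n p q : nat}
    (X : T -> 'M[R]_(m, n)) (Y : T -> 'M[R]_(p, q)) : Prop :=
  forall E F : set T, sigma_of_mx X E -> sigma_of_mx Y F ->
    P (E `&` F) = (P E * P F)%E.

Record GOE {n : nat} (A : T -> 'M[R]_n) : Prop := {
  GOE_measurable : forall i j, measurable_fun setT (fun w => A w i j) ;
  GOE_symmetric : forall w i j, A w i j = A w j i ;
  GOE_diag : forall i, normal_law (fun w => A w i i) (2 / n%:R) ;
  GOE_offdiag : forall i j, i != j ->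
    normal_law (fun w => A w i j) (1 / n%:R) ;
  GOE_independent :
    mutually_independent [pred ij : 'I_n * 'I_n | (ij.1 <= ij.2)%N]
      (fun ij w => A w ij.1 ij.2) }.

Definition gaussian_wigner {n : nat} (sigma : R) (pi : {perm 'I_n})
    (A B : T -> 'M[R]_n) : Prop :=
  exists Z : T -> 'M[R]_n,
    [/\ GOE A, GOE Z, independent_mx A Z &
        forall w i j, B w (pi i) (pi j) = A w i j + sigma * Z w i j].

End random_matrices.

(* P n (E n) tends to 1. The events E n may fail to be measurable, since they
   may depend on an arbitrary (nonmeasurable) choice of minimizers or
   maximizers, hence the inner approximations F n; see with_high_probabilityP
   for the measurable case. *)
Definition with_high_probability {R : realType} {d : nat -> measure_display}
    {T : forall n, measurableType (d n)} (P : forall n, probability (T n) R)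
    (E : forall n, set (T n)) : Prop :=
  exists F : forall n, set (T n),
    [/\ forall n, measurable (F n), forall n, F n `<=` E n &
        P n (F n) @[n --> \oo] --> 1%E].

Lemma with_high_probabilityP {R : realType} {d : nat -> measure_display}
    {T : forall n, measurableType (d n)} (P : forall n, probability (T n) R)
    (E : forall n, set (T n)) : (forall n, measurable (E n)) ->
  with_high_probability P E <-> P n (E n) @[n --> \oo] --> 1%E.
Proof.
move=> mE; split=> [[F [mF FE cvgF]]|cvgE]; last by exists E; split=> // n t.
apply: (@squeeze_cvge _ _ _ _ (fun n => P n (F n)) _ (fun=> 1%E)) => //.
  apply: nearW => n; rewrite probability_le1// andbT.
  by apply: le_measure; rewrite ?inE//; exact: FE.
exact: cvg_cst.
Qed.

(* Main.v *)
Require Import Defs.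
From HB Require Import structures.
From mathcomp Require Import all_boot all_order all_algebra all_fingroup.
From mathcomp Require Import all_classical all_reals all_analysis.
From mathcomp Require Import measurable_realfun complex spectral ring lra.

(* Write pi for pistar, Y_ik = Xstar_{i, pi k} and W = 1 - Y. Comparing Xstar with
   the permutation matrix of pi gives |AW - WA|_F^2 <= 4 sigma^2 |Z|_F^2; moreover
   W kills e = (1, ..., 1) / sqrt n on both sides and has operator norm at most 2,
   and the number of errors is O(|W|_F^2).
   Let A' be the compression of A to the orthogonal complement of e, let X be the
   component of A e in that complement, f = X / |X|, and let A'' be the compression
   of A' to the orthogonal complement of f. If w_i, z_j are eigenbases of A', A''
   with eigenvalues mu_i, nu_j, then
     (mu_i - nu_j) <w_i, z_j> = <w_i, f> <z_j, A' f>,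
   which bounds |mu_i - nu_j| from below without any knowledge of eigenvalue
   spacings. Inserted in the commutator bound, this controls <w_i, W z_j> as soon
   as <w_i, X> and <z_j, A' f> are not too small; each exceptional index i or j
   costs only O(1) in |W|_F^2, because |W| <= 2.
   The small-ball bounds for these two linear forms come from the Cameron-Martin
   formula: adding t (e w^T + w e^T) to A leaves A', hence w, unchanged and moves
   <w, X> by t, and similarly for the second form with f and z inside the
   complement of e. So that everything is measurable, the eigenvectors and f are
   computed from matrices rounded to a fine grid: only countably many values occur. *)

Set Implicit Arguments.
Unset Strict Implicit.
Unset Printing Implicit Defensive.

Import Order.TTheory GRing.Theory Num.Theory.
Import numFieldNormedType.Exports.

Local Open Scope classical_set_scope.
Local Open Scope ring_scope.

(** * Frobenius norm and spectral theorem *)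

Section squared_frobenius_norm.
Context {R : realFieldType}.

(** The square keeps the compression estimates inside an arbitrary ordered field;
    [frobenius_norm_sqr] links it to [frobenius_norm]. *)
Definition fnorm2 {m n} (M : 'M[R]_(m, n)) : R := \sum_i \sum_j M i j ^+ 2.

Lemma fnorm2_ge0 m n (M : 'M[R]_(m, n)) : 0 <= fnorm2 M.
Proof. by apply: sumr_ge0 => i _; apply: sumr_ge0 => j _; exact: sqr_ge0. Qed.

Lemma fnorm2E m n (M : 'M[R]_(m, n)) : fnorm2 M = \tr (M *m M^T).
Proof.
by apply: eq_bigr => i _; rewrite mxE; apply: eq_bigr => j _; rewrite mxE expr2.
Qed.

Lemma fnorm2_tr m n (M : 'M[R]_(m, n)) : fnorm2 M^T = fnorm2 M.
Proof.
rewrite /fnorm2 exchange_big; apply: eq_bigr => i _; apply: eq_bigr => j _.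
by rewrite mxE.
Qed.

Lemma fnorm2N m n (M : 'M[R]_(m, n)) : fnorm2 (- M) = fnorm2 M.
Proof.
by apply: eq_bigr => i _; apply: eq_bigr => j _; rewrite mxE sqrrN.
Qed.

Lemma fnorm2Z m n a (M : 'M[R]_(m, n)) : fnorm2 (a *: M) = a ^+ 2 * fnorm2 M.
Proof.
rewrite mulr_sumr; apply: eq_bigr => i _; rewrite mulr_sumr.
by apply: eq_bigr => j _; rewrite mxE exprMn.
Qed.

Lemma fnorm2D_le m n (M N : 'M[R]_(m, n)) :
  fnorm2 (M + N) <= 2 * fnorm2 M + 2 * fnorm2 N.
Proof.
rewrite !mulr_sumr -big_split; apply: ler_sum => i _.
rewrite !mulr_sumr -big_split; apply: ler_sum => j _; rewrite mxE /=.
by have := sqr_ge0 (M i j - N i j); nra.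
Qed.

Lemma fnorm2B_le m n (M N : 'M[R]_(m, n)) :
  fnorm2 (M - N) <= 2 * fnorm2 M + 2 * fnorm2 N.
Proof. by rewrite -(fnorm2N N); exact: fnorm2D_le. Qed.

Lemma sqr_le_fnorm2 m n (M : 'M[R]_(m, n)) i j : M i j ^+ 2 <= fnorm2 M.
Proof.
rewrite /fnorm2 (bigD1 i)//= (bigD1 j)//= -addrA lerDl addr_ge0//.
  by apply: sumr_ge0 => k _; exact: sqr_ge0.
by apply: sumr_ge0 => k _; apply: sumr_ge0 => l _; exact: sqr_ge0.
Qed.

Lemma fnorm2_row m n (M : 'M[R]_(m, n)) i : fnorm2 (row i M) = \sum_j M i j ^+ 2.
Proof. by rewrite /fnorm2 big_ord1; apply: eq_bigr => j _; rewrite mxE. Qed.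

Lemma fnorm2_isoml m n p (U : 'M[R]_(m, n)) (M : 'M[R]_(n, p)) :
  U^T *m U = 1%:M -> fnorm2 (U *m M) = fnorm2 M.
Proof.
move=> UU; rewrite -fnorm2_tr fnorm2E trmxK trmx_mul -mulmxA [U^T *m _]mulmxA UU.
by rewrite mul1mx -{2}[M]trmxK -fnorm2E fnorm2_tr.
Qed.

Lemma fnorm2_isomr m n p (U : 'M[R]_(m, n)) (M : 'M[R]_(p, n)) :
  U^T *m U = 1%:M -> fnorm2 (M *m U^T) = fnorm2 M.
Proof. by move=> UU; rewrite -fnorm2_tr trmx_mul trmxK fnorm2_isoml// fnorm2_tr. Qed.

(** The difference of the two sides is the squared norm of M - U^T U M, the residual of an
    orthogonal projection. *)
Lemma fnorm2_coisoml_le m n p (U : 'M[R]_(m, n)) (M : 'M[R]_(n, p)) :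
  U *m U^T = 1%:M -> fnorm2 (U *m M) <= fnorm2 M.
Proof.
move=> UU; rewrite -subr_ge0.
suff -> : fnorm2 M - fnorm2 (U *m M) = fnorm2 (M - U^T *m (U *m M)).
  exact: fnorm2_ge0.
have fE q r (N : 'M[R]_(q, r)) : fnorm2 N = \tr (N^T *m N).
  by rewrite -fnorm2_tr fnorm2E trmxK.
rewrite !fE -[LHS]raddfB/= [(M - _)^T]linearB/= !trmx_mul !trmxK mulmxBl !mulmxBr.
rewrite -!mulmxA [U *m (U^T *m _)]mulmxA UU mul1mx.
by rewrite subrr subr0.
Qed.

Lemma fnorm2_coisomr_le m n p (U : 'M[R]_(m, n)) (M : 'M[R]_(p, n)) :
  U *m U^T = 1%:M -> fnorm2 (M *m U^T) <= fnorm2 M.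
Proof.
by move=> UU; rewrite -fnorm2_tr trmx_mul trmxK -(fnorm2_tr M) fnorm2_coisoml_le.
Qed.

Lemma row_coisom m n (U : 'M[R]_(m, n)) i :
  U *m U^T = 1%:M -> fnorm2 (row i U) = 1.
Proof.
move=> UU; rewrite fnorm2_row; have /matrixP/(_ i i) := UU.
by rewrite !mxE eqxx mulr1n => <-; apply: eq_bigr => j _; rewrite mxE expr2.
Qed.

End squared_frobenius_norm.

Section spectral.
Context {R : rcfType}.

(* The rows of U are all but the first row of a Householder reflection that
   maps e to the first basis vector up to sign. *)
Lemma orthogonal_complement n (e : 'cV[R]_n.+1) : e^T *m e = 1%:M ->
  exists U : 'M[R]_(n, n.+1),
    [/\ U *m U^T = 1%:M, U^T *m U = 1%:M - e *m e^T & U *m e = 0].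
Proof.
move=> ee.
(* This sign makes c e_00 <= 0, so that b = |v|^2 = 2 - 2 c e_00 is at least 2 and the reflection
   along v = e - c d is well defined. *)
pose c : R := if e 0 0 <= 0 then 1 else -1.
have cc : c * c = 1 by rewrite /c; case: ifP => _; rewrite ?mulr1// mulrNN mulr1.
have ce : c * e 0 0 <= 0.
  rewrite /c; case: ifPn => [|]; first by rewrite mul1r.
  by rewrite -ltNge mulN1r oppr_le0 => /ltW.
pose d : 'cV[R]_n.+1 := delta_mx 0 0.
have dd : d^T *m d = 1%:M.
  by apply/matrixP => i j; rewrite trmx_delta mul_delta_mx !ord1 !mxE.
have ed : e^T *m d = (e 0 0)%:M.
  by apply/matrixP => i j; rewrite !ord1 -colE !mxE eqxx mulr1n.
have de : d^T *m e = (e 0 0)%:M by rewrite -[LHS]trmxK trmx_mul trmxK ed tr_scalar_mx.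
pose v := e - c *: d.
pose b : R := 2 - 2 * (c * e 0 0).
have b0 : b != 0 by rewrite gt_eqF// /b; nra.
have ve : v^T *m e = (b / 2)%:M.
  rewrite /v linearB linearZ/= mulmxBl ee -scalemxAl de scale_scalar_mx.
  by rewrite -raddfB/=; congr (_%:M); rewrite /b; field.
have vd : v^T *m d = (- (c * b / 2))%:M.
  rewrite /v linearB linearZ/= mulmxBl ed -scalemxAl dd scale_scalar_mx.
  rewrite -raddfB/=; congr (_%:M).
  have -> : c * b / 2 = c - c * c * e 0 0 by rewrite /b; field.
  by rewrite cc mul1r opprB mulr1.
have vv : v^T *m v = b%:M.
  rewrite {2}/v mulmxBr -scalemxAr ve vd scale_scalar_mx -raddfB/=; congr (_%:M).
  have -> : b / 2 - c * - (c * b / 2) = b / 2 + (c * c) * (b / 2) by ring.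
  by rewrite cc; field.
pose H := 1%:M - (2 / b) *: (v *m v^T).
have HT : H^T = H.
  by rewrite /H linearB linearZ/= trmx1 trmx_mul trmxK.
have HH : H *m H = 1%:M.
  rewrite {2}/H mulmxBr mulmx1 -scalemxAr mulmxA.
  have -> : H *m v = - v.
    rewrite /H mulmxBl mul1mx -scalemxAl -mulmxA vv mul_mx_scalar.
    by rewrite scalerA divfK// scaler_nat mulr2n opprD addrA subrr add0r.
  by rewrite mulNmx scalerN opprK /H subrK.
have Hd : H *m d = c *: e.
  rewrite /H mulmxBl mul1mx -scalemxAl -mulmxA vd mul_mx_scalar.
  rewrite scalerA mulrN scaleNr opprK.
  have -> : 2 / b * (c * b / 2) = c by field.
  by rewrite /v scalerBr scalerA cc scale1r addrC subrK.
pose U : 'M[R]_(n, n.+1) := dsubmx (H : 'M[R]_(1 + n, n.+1)).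
(* H maps the first basis vector to c e, so its first row is c e^T. The block forms of H H^T = 1 and
   H^T H = 1 then give the three properties of U. *)
have HE : (H : 'M[R]_(1 + n, n.+1)) = col_mx (c *: e^T) U.
  rewrite -[LHS](@vsubmxK _ 1 n); congr col_mx.
  have -> : c *: e^T = d^T *m H by rewrite -[RHS]trmxK trmx_mul trmxK HT Hd linearZ.
  by rewrite trmx_delta -rowE; apply/rowP => j; rewrite [LHS]mxE [RHS]mxE;
    congr (H _ _); apply/val_inj.
have [UU Ue] : U *m U^T = 1%:M /\ U *m e = 0.
  have : (H : 'M[R]_(1 + n, n.+1)) *m (H : 'M[R]_(1 + n, n.+1))^T = 1%:M by rewrite HT.
  rewrite HE tr_col_mx mul_col_row (scalar_mx_block 1 n) => /eq_block_mx[_ _].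
  rewrite [(c *: _)^T]linearZ/= trmxK -scalemxAr => Ue ->; split => //.
  by move: Ue => /(congr1 (fun z => c *: z)); rewrite /= scalerA cc scale1r scaler0.
exists U; split=> //.
have : (H : 'M[R]_(1 + n, n.+1))^T *m (H : 'M[R]_(1 + n, n.+1)) = 1%:M by rewrite HT.
rewrite HE tr_col_mx mul_row_col [(c *: _)^T]linearZ/= trmxK -scalemxAr -scalemxAl scalerA cc.
by rewrite scale1r => <-; rewrite addrAC subrr add0r.
Qed.

(** Over the complex extension, the Hermitian spectral theorem gives a real eigenvalue. It is a root
    of the characteristic polynomial, whose coefficients lie in R, so S has an eigenvector over R,
    which is then normalized. *)
Lemma real_eigenvector n (S : 'M[R]_n.+1) : S^T = S ->
  exists (e : 'cV[R]_n.+1) (a : R), e^T *m e = 1%:M /\ S *m e = a *: e.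
Proof.
move=> symS; pose f := real_complex R; pose SC := map_mx f S.
have symSC : SC \is symmetricmx.
  apply/is_hermitianmxP; rewrite expr0 scale1r.
  by apply/matrixP => i j; rewrite !mxE /= -{1}symS mxE.
have realSC : SC \is a mxOver Num.real.
  by apply/mxOverP => i j; rewrite mxE; apply/complex_realP; exists (S i j).
have /mxOverP realS := hermitian_spectral_diag_real (realsym_hermsym symSC realSC).
have normS := symmetric_normalmx symSC realSC.
have /complex_realP[a aE] := realS 0 0.
have : eigenvalue SC (f a).
  apply/eigenvalueP; exists (row 0 (spectralmx SC)).
    rewrite -row_mul [in X in _ *m X](orthomx_spectralP normS) -mulmxA mulKVmx ?spectral_unit//.
    by rewrite mul_diag_mx; apply/rowP => j; rewrite !mxE aE.
  apply/eqP => row0.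
  have /unitarymxP/matrixP/(_ 0 0) := spectral_unitarymx SC.
  rewrite !mxE eqxx big1 => [/esym/eqP|j _]; first by rewrite oner_eq0.
  by have /rowP/(_ j) := row0; rewrite !mxE => ->; rewrite mul0r.
rewrite eigenvalue_root_char -map_char_poly fmorph_root -eigenvalue_root_char.
move=> /eigenvalueP[v vS v0].
have q0 : 0 < fnorm2 v.
  rewrite lt_def fnorm2_ge0 andbT; apply: contra v0 => /eqP fv0.
  apply/eqP/rowP => j; apply/eqP; rewrite mxE -sqrf_eq0 eq_le sqr_ge0 andbT.
  by rewrite -fv0 sqr_le_fnorm2.
exists ((Num.sqrt (fnorm2 v))^-1 *: v^T), a; split.
  have vv : v *m v^T = (fnorm2 v)%:M.
    apply/matrixP => i j; rewrite !ord1 fnorm2E [X in _ = X]mxE eqxx mulr1n.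
    by rewrite /mxtrace big_ord1.
  rewrite [(_ *: v^T)^T]linearZ/= trmxK -scalemxAl -scalemxAr scalerA vv scale_scalar_mx.
  by rewrite -invfM -expr2 sqr_sqrtr ?mulVf ?gt_eqF// ltW.
by rewrite -scalemxAr -{1}symS -trmx_mul vS linearZ/= scalerA mulrC -scalerA.
Qed.

(** Induction on the size: a unit eigenvector e is split off and the compression of S to its
    complement is diagonalized. Symmetry of S makes that complement invariant. *)
Lemma real_spectral n (S : 'M[R]_n) : S^T = S ->
  exists (O : 'M[R]_n) (d : 'rV[R]_n),
    [/\ O *m O^T = 1%:M, O^T *m O = 1%:M & O *m S = diag_mx d *m O].
Proof.
elim: n S => [|n IHn] S symS.
  by exists 1%:M, 0; split; apply/matrixP => -[].
have [e [a [ee Se]]] := real_eigenvector symS.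
have [U [UU1 UU2 Ue]] := orthogonal_complement ee.
have [|O [d [OO1 OO2 OS]]] := IHn (U *m S *m U^T).
  by rewrite !trmx_mul trmxK symS mulmxA.
have eS : e^T *m S = a *: e^T by rewrite -[LHS]trmxK trmx_mul trmxK symS Se linearZ.
have eU : e^T *m U^T = 0 by rewrite -trmx_mul Ue trmx0.
pose Q : 'M[R]_(1 + n) := col_mx e^T (O *m U).
have QQ : Q *m Q^T = 1%:M.
  rewrite tr_col_mx mul_col_row trmx_mul trmxK ee mulmxA eU mul0mx -mulmxA Ue mulmx0.
  by rewrite mulmxA -[ O *m U *m _]mulmxA UU1 mulmx1 OO1 -scalar_mx_block.
exists Q, (row_mx a%:M d : 'rV_(1 + n)); split => //.
  exact: mulmx1C.
have -> : diag_mx (row_mx a%:M d) *m Q = col_mx (a *: e^T) (diag_mx d *m (O *m U)).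
  rewrite diag_mx_row mul_block_col !mul0mx addr0 add0r; congr col_mx.
  by rewrite mul_diag_mx; apply/matrixP => i j; rewrite !mxE !ord1 eqxx mulr1n.
have -> : Q *m S = col_mx (e^T *m S) (O *m U *m S) by exact: mul_col_mx.
suff -> : O *m U *m S = diag_mx d *m (O *m U) by rewrite eS.
have -> : O *m U *m S = O *m (U *m S *m U^T) *m U.
  rewrite -!mulmxA UU2 mulmxBr mulmx1 [S *m _]mulmxA Se -scalemxAl mulmxBr -scalemxAr.
  by rewrite [U *m (e *m _)]mulmxA Ue mul0mx scaler0 subr0.
by rewrite OS mulmxA.
Qed.

End spectral.

(** * Compression of the commutator equation *)

Section mixed_basis.
Context {R : realFieldType}.

Lemma sum_rows_le m n (D : 'M[R]_(m, n)) (I : pred 'I_m) (c : R) :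
  (forall i, fnorm2 (row i D) <= c) ->
  \sum_(i | I i) \sum_j D i j ^+ 2 <= c * #|I|%:R.
Proof.
move=> Dc; rewrite mulr_natr -sumr_const; apply: ler_sum => i _.
by rewrite -fnorm2_row.
Qed.

(** The scalar estimate for one pair of eigenvectors: delta = mu_i - nu_j, C = <w_i, z_j>, D = <w_i,
    W z_j>, b = <w_i, f>, g = <w_i, W f>, x = <z_j, A' f>. S collects rounding errors, and E also
    the commutator. Since |C| <= 1 and S is small against b x, the first equation gives |delta| >=
    |b x| / 2; the second then bounds D. The lower bound s concerns xi * b because this is <w_i, X>,
    the form that small-ball estimates control. *)
Lemma mixed_entry_bound (delta C b x S g E D xi K s t kappa : R) :
  delta * C = b * x + S -> delta * D = g * x + E ->
  C ^+ 2 <= 1 -> S ^+ 2 <= 4 * kappa -> xi ^+ 2 <= K ->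
  0 < s -> s <= `|xi * b| -> 0 < t -> t <= `|x| ->
  64 * K * kappa <= (s * t) ^+ 2 ->
  D ^+ 2 <= 8 * K / (s * t) ^+ 2 * E ^+ 2 + 8 / s ^+ 2 * (xi * g) ^+ 2.
Proof.
move=> eqC eqD C1 Sk xiK s0 sb t0 tx kK.
have q0 : 0 < (s * t) ^+ 2 by rewrite exprn_gt0// mulr_gt0.
have b2 : s ^+ 2 <= (xi * b) ^+ 2.
  by rewrite -[leRHS]real_normK ?num_real// lerXn2r// ?nnegrE ?(ltW s0).
have x2 : t ^+ 2 <= x ^+ 2.
  by rewrite -[leRHS]real_normK ?num_real// lerXn2r// ?nnegrE ?(ltW t0).
have s20 : 0 < s ^+ 2 by rewrite exprn_gt0.
have t20 : 0 < t ^+ 2 by rewrite exprn_gt0.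
have y2 : (s * t) ^+ 2 <= (xi * b) ^+ 2 * x ^+ 2 by rewrite exprMn ler_pM// ltW.
have K0 : 0 < K.
  apply: lt_le_trans xiK; rewrite lt_def sqr_ge0 andbT sqrf_eq0.
  by apply: contraTneq b2 => ->; rewrite mul0r expr0n/= -ltNge.
have kbx : 64 * kappa <= (b * x) ^+ 2.
  have : K * (64 * kappa) <= K * (b * x) ^+ 2.
    rewrite mulrCA mulrA; apply: le_trans kK (le_trans y2 _).
    rewrite exprMn -mulrA -exprMn; apply: ler_wpM2r xiK.
    exact: sqr_ge0.
  by rewrite ler_pM2l.
have dbx : (b * x) ^+ 2 <= 4 * delta ^+ 2.
  have : (b * x + S) ^+ 2 <= delta ^+ 2.
    by rewrite -eqC exprMn ler_piMr// sqr_ge0.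
  have := sqr_ge0 (b * x + S + S); nra.
have Dy : D ^+ 2 * (b * x) ^+ 2 <= 8 * E ^+ 2 + 8 * g ^+ 2 * x ^+ 2.
  have : D ^+ 2 * (b * x) ^+ 2 <= 4 * (delta * D) ^+ 2.
    have -> : 4 * (delta * D) ^+ 2 = D ^+ 2 * (4 * delta ^+ 2) by ring.
    by rewrite ler_wpM2l// sqr_ge0.
  by rewrite eqD; have := sqr_ge0 (g * x - E); nra.
have y0 : 0 < (xi * b) ^+ 2 * x ^+ 2 := lt_le_trans q0 y2.
have Dy' : D ^+ 2 * ((xi * b) ^+ 2 * x ^+ 2) <=
    8 * K * E ^+ 2 + 8 * (xi * g) ^+ 2 * x ^+ 2.
  have : xi ^+ 2 * (D ^+ 2 * (b * x) ^+ 2) <=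
      xi ^+ 2 * (8 * E ^+ 2 + 8 * g ^+ 2 * x ^+ 2).
    by rewrite ler_wpM2l// sqr_ge0.
  have : xi ^+ 2 * E ^+ 2 <= K * E ^+ 2 by rewrite ler_wpM2r// sqr_ge0.
  by rewrite !exprMn; lra.
rewrite -(ler_pM2r y0); apply: (le_trans Dy'); rewrite [leRHS]mulrDl lerD//.
  have -> : 8 * K * E ^+ 2 = 8 * K / (s * t) ^+ 2 * E ^+ 2 * (s * t) ^+ 2.
    by rewrite [RHS]mulrAC divfK// gt_eqF.
  rewrite ler_wpM2l//; apply: mulr_ge0 (sqr_ge0 _).
  by apply: mulr_ge0; [rewrite mulr_ge0// ltW|rewrite invr_ge0 ltW].
have -> : 8 * (xi * g) ^+ 2 * x ^+ 2 =
    8 / s ^+ 2 * (xi * g) ^+ 2 * (s ^+ 2 * x ^+ 2).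
  by rewrite [RHS]mulrA [_ * s ^+ 2]mulrAC divfK// gt_eqF.
rewrite ler_wpM2l ?ler_wpM2r ?sqr_ge0//.
by apply: mulr_ge0 (sqr_ge0 _); rewrite divr_ge0// ltW.
Qed.

Lemma addr_rearrange (V : zmodType) (a b c d e : V) :
  a + b = c + d + e -> a - c = d + (e - b).
Proof.
move=> h; apply/eqP; rewrite subr_eq -[a](addrK b) h -addrA [c + d]addrC.
by rewrite addrAC.
Qed.

Lemma subr_rearrange (V : zmodType) (a b c d e g : V) :
  a + b - (c + d + e) = g -> a - c = d + (g + (e - b)).
Proof.
move=> <-; rewrite addrAC [a + b + _]addrACA subrr addr0.
by rewrite opprD addrACA subrr addr0 opprD addrCA [- c - d]addrC addNKr.
Qed.

(** The rows of O and Z are the eigenbases w_i and z_j, up to residuals R1 and R2 caused by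
    rounding. Pairs in I x J are handled by [mixed_entry_bound]; each row outside I and each column
    outside J of O W Z^T has squared norm at most 4, and so does W f. *)
Lemma mixed_basis_bound m (A W O : 'M[R]_m.+1) (Z : 'M[R]_(m, m.+1))
    (f X : 'cV[R]_m.+1) (mu : 'rV[R]_m.+1) (nu x : 'rV[R]_m)
    (R1 : 'M[R]_m.+1) (R2 : 'M[R]_(m.+1, m)) (xi K s t kappa : R)
    (I : pred 'I_m.+1) (J : pred 'I_m) :
  O *m O^T = 1%:M -> O^T *m O = 1%:M ->
  Z *m Z^T = 1%:M -> Z^T *m Z = 1%:M - f *m f^T -> f^T *m f = 1%:M ->
  (forall p (M : 'M[R]_(m.+1, p)), fnorm2 (W *m M) <= 4 * fnorm2 M) ->
  (forall p (M : 'M[R]_(m.+1, p)), fnorm2 (W^T *m M) <= 4 * fnorm2 M) ->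
  O *m A = diag_mx mu *m O + R1 ->
  A *m Z^T = Z^T *m diag_mx nu + f *m x + R2 ->
  fnorm2 R1 <= kappa -> fnorm2 R2 <= kappa ->
  X = xi *: f -> xi ^+ 2 <= K ->
  0 < s -> (forall i, I i -> s <= `|(O *m X) i 0|) ->
  0 < t -> (forall j, J j -> t <= `|x 0 j|) ->
  64 * K * kappa <= (s * t) ^+ 2 ->
  fnorm2 W <= 4 + 4 * #|predC I|%:R + 4 * #|predC J|%:R
    + 16 * K / (s * t) ^+ 2 * (fnorm2 (A *m W - W *m A) + 16 * kappa)
    + 8 * m%:R / s ^+ 2 * fnorm2 (W *m X).
Proof.
move=> OO OO' ZZ ZZ' ff W4 WT4 OA AZ R1k R2k XE xiK s0 HI t0 HJ kappaK.
have OfT p (M : 'M[R]_(m.+1, p)) : fnorm2 (O *m M) = fnorm2 M.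
  exact: fnorm2_isoml.
have ZT_le p (M : 'M[R]_(p, m.+1)) : fnorm2 (M *m Z^T) <= fnorm2 M.
  exact: fnorm2_coisomr_le.
have Wr4 p (M : 'M[R]_(p, m.+1)) : fnorm2 (M *m W) <= 4 * fnorm2 M.
  by rewrite -fnorm2_tr trmx_mul (le_trans (WT4 _ _))// fnorm2_tr.
pose D := O *m W *m Z^T; pose g := O *m W *m f; pose b := O *m f.
pose C := O *m Z^T.
pose S1 := O *m R2 - R1 *m Z^T.
pose E := O *m (A *m W - W *m A) *m Z^T + (O *m W *m R2 - R1 *m W *m Z^T).
have kappa0 : 0 <= kappa := le_trans (fnorm2_ge0 _) R1k.
have K0 : 0 <= K := le_trans (sqr_ge0 _) xiK.
have S1k : fnorm2 S1 <= 4 * kappa.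
  apply: le_trans (fnorm2B_le _ _) _; rewrite OfT.
  by have := ZT_le _ R1; lra.
have Ek : fnorm2 E <= 2 * (fnorm2 (A *m W - W *m A) + 16 * kappa).
  apply: le_trans (fnorm2D_le _ _) _.
  have := ZT_le _ (O *m (A *m W - W *m A)); rewrite OfT.
  have := fnorm2B_le (O *m W *m R2) (R1 *m W *m Z^T).
  rewrite -{2}[ O *m W *m R2]mulmxA OfT.
  by have := W4 _ R2; have := ZT_le _ (R1 *m W); have := Wr4 _ R1; lra.
(* O A Z^T is computed in two ways, through the eigen-equation of each basis. *)
have eqC : diag_mx mu *m C - C *m diag_mx nu = b *m x + S1.
  apply: addr_rearrange; have : O *m A *m Z^T = O *m (A *m Z^T) by rewrite mulmxA.
  by rewrite OA AZ mulmxDl !mulmxDr !mulmxA.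
(* The same computation for O (A W - W A) Z^T; the commutator goes into E. *)
have eqD : diag_mx mu *m D - D *m diag_mx nu = g *m x + E.
  apply: subr_rearrange.
  have <- : O *m A *m W *m Z^T - O *m W *m (A *m Z^T) =
      O *m (A *m W - W *m A) *m Z^T by rewrite mulmxBr mulmxBl !mulmxA.
  by rewrite OA AZ 2!mulmxDl !mulmxDr !mulmxA.
have Cij i j : C i j ^+ 2 <= 1.
  have := sqr_le_fnorm2 (row i C) 0 j; rewrite mxE => /le_trans; apply.
  by rewrite /C row_mul (le_trans (ZT_le _ _))// row_coisom.
(* The rows of Z together with f form an orthonormal basis, which splits |W|_F^2. *)
have fnW : fnorm2 W = fnorm2 D + fnorm2 g.
  rewrite -(OfT _ W) !fnorm2E -raddfD/=; congr (\tr _).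
  have sum1 : Z^T *m Z + f *m f^T = 1%:M by rewrite ZZ' subrK.
  rewrite -{1}[ O *m W]mulmx1 -sum1 /D /g !trmx_mul !trmxK !mulmxDr !mulmxDl.
  by rewrite !mulmxA.
have g4 : fnorm2 g <= 4.
  rewrite /g -mulmxA OfT (le_trans (W4 _ _))// -{2}[4]mulr1 ler_pM2l//.
  by rewrite -fnorm2_tr fnorm2E trmxK ff mxtrace1.
have bad_rows : \sum_(i | predC I i) \sum_j D i j ^+ 2 <= 4 * #|predC I|%:R.
  apply: sum_rows_le => i; rewrite /D !row_mul (le_trans (ZT_le _ _))//.
  by rewrite (le_trans (Wr4 _ _))// row_coisom// mulr1.
have bad_cols : \sum_(j | predC J j) \sum_i D i j ^+ 2 <= 4 * #|predC J|%:R.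
  have := @sum_rows_le _ _ D^T (predC J) 4.
  under [leLHS]eq_bigr do under eq_bigr do rewrite mxE.
  apply => j; rewrite -fnorm2_tr tr_row trmxK /D -mulmxA.
  rewrite colE -!mulmxA OfT (le_trans (W4 _ _))// -colE -tr_row fnorm2_tr.
  by rewrite row_coisom ?mulr1.
have good i j : I i -> J j ->
    D i j ^+ 2 <= 8 * K / (s * t) ^+ 2 * E i j ^+ 2
                  + 8 / s ^+ 2 * (O *m W *m X) i 0 ^+ 2.
  move=> Ii Jj.
  have -> : (O *m W *m X) i 0 = xi * g i 0 by rewrite XE -scalemxAr [LHS]mxE.
  apply: (@mixed_entry_bound (mu 0 i - nu 0 j) (C i j) (b i 0) (x 0 j) (S1 i j)
    _ _ _ _ _ _ _ kappa) => //.
  - move/matrixP/(_ i j): eqC; rewrite mul_diag_mx mul_mx_diag !mxE big_ord1.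
    by rewrite !mxE => <-; ring.
  - move/matrixP/(_ i j): eqD; rewrite mul_diag_mx mul_mx_diag !mxE big_ord1.
    by rewrite !mxE => <-; ring.
  - exact: le_trans (sqr_le_fnorm2 S1 i j) S1k.
  - have -> : xi * b i 0 = (O *m X) i 0 by rewrite XE -scalemxAr [RHS]mxE.
    exact: HI.
  - exact: HJ.
have fD : fnorm2 D <= 4 * #|predC I|%:R + 4 * #|predC J|%:R +
    \sum_(i | I i) \sum_(j | J j) D i j ^+ 2.
  rewrite /fnorm2 (bigID I)/= addrC -addrA lerD//.
  under eq_bigr do rewrite (bigID J)/=.
  rewrite big_split/= addrC lerD//; apply: le_trans bad_cols.
  rewrite exchange_big/=; apply: ler_sum => j _.
  rewrite [leRHS](bigID I)/= lerDl; apply: sumr_ge0 => i _; exact: sqr_ge0.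
have fIJ : \sum_(i | I i) \sum_(j | J j) D i j ^+ 2 <=
    8 * K / (s * t) ^+ 2 * fnorm2 E + 8 * m%:R / s ^+ 2 * fnorm2 (W *m X).
  have c0 : 0 <= 8 * K / (s * t) ^+ 2 by rewrite !mulr_ge0// ?invr_ge0 ?sqr_ge0.
  have d0 : 0 <= 8 / s ^+ 2 by rewrite !mulr_ge0// ?invr_ge0 ?sqr_ge0.
  apply: (@le_trans _ _ (\sum_i \sum_j (8 * K / (s * t) ^+ 2 * E i j ^+ 2
                  + 8 / s ^+ 2 * (O *m W *m X) i 0 ^+ 2))).
    rewrite [leRHS](bigID I)/= -[leLHS]addr0 lerD//; last first.
      apply: sumr_ge0 => i _; apply: sumr_ge0 => j _.
      by rewrite addr_ge0// mulr_ge0// sqr_ge0.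
    apply: ler_sum => i Ii; rewrite [leRHS](bigID J)/= -[leLHS]addr0 lerD//.
      by apply: ler_sum => j Jj; exact: good.
    by apply: sumr_ge0 => j _; rewrite addr_ge0// mulr_ge0// sqr_ge0.
  under eq_bigr do rewrite big_split/= -mulr_sumr sumr_const card_ord.
  rewrite big_split/= -mulr_sumr lerD// sumrMnl -mulr_sumr -[leLHS]mulr_natr.
  rewrite -(OfT _ (W *m X)) /fnorm2 mulmxA.
  under [in leRHS]eq_bigr do rewrite big_ord1.
  by rewrite [leLHS]mulrAC [X in X * _ <= _]mulrAC.
have c0 : 0 <= 8 * K / (s * t) ^+ 2 by rewrite !mulr_ge0// ?invr_ge0 ?sqr_ge0.
have := ler_wpM2l c0 Ek.
have -> : 16 * K / (s * t) ^+ 2 = 2 * (8 * K / (s * t) ^+ 2) by rewrite !mulrA -natrM.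
by rewrite fnW; lra.
Qed.

End mixed_basis.

Section two_step_compression.
Context {R : realFieldType}.

(** Since W kills e on both sides, replacing it by U W U^T preserves its norm and turns the
    commutator with A into a compression of it. [A1], [X] and [A2] are rounded versions of A' = U A
    U^T, U A e and V A' V^T: the eigenbases are exact for them and approximate for the true
    compressions. *)
Lemma compression_bound m (A W : 'M[R]_m.+2) (e : 'cV[R]_m.+2)
    (U : 'M[R]_(m.+1, m.+2)) (A1 O : 'M[R]_m.+1) (X f : 'cV[R]_m.+1)
    (V : 'M[R]_(m, m.+1)) (A2 O2 : 'M[R]_m) (mu : 'rV[R]_m.+1) (nu : 'rV[R]_m)
    (xi K s t kappa : R) (I : pred 'I_m.+1) (J : pred 'I_m) :
  U *m U^T = 1%:M -> U^T *m U = 1%:M - e *m e^T -> e^T *m e = 1%:M ->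
  A^T = A -> W *m e = 0 -> e^T *m W = 0 ->
  (forall p (M : 'M[R]_(m.+2, p)), fnorm2 (W *m M) <= 4 * fnorm2 M) ->
  (forall p (M : 'M[R]_(m.+2, p)), fnorm2 (W^T *m M) <= 4 * fnorm2 M) ->
  O *m O^T = 1%:M -> O^T *m O = 1%:M -> O *m A1 = diag_mx mu *m O ->
  fnorm2 (U *m A *m U^T - A1) <= kappa ->
  fnorm2 (U *m A *m e - X) <= kappa ->
  X = xi *: f -> f^T *m f = 1%:M -> fnorm2 X <= K ->
  V *m V^T = 1%:M -> V^T *m V = 1%:M - f *m f^T ->
  O2 *m O2^T = 1%:M -> O2^T *m O2 = 1%:M -> O2 *m A2 = diag_mx nu *m O2 ->
  A2^T = A2 -> fnorm2 (V *m (U *m A *m U^T) *m V^T - A2) <= kappa ->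
  0 < s -> (forall i, I i -> s <= `|(O *m X) i 0|) ->
  0 < t -> (forall j, J j -> t <= `|(O2 *m V *m (U *m A *m U^T) *m f) j 0|) ->
  64 * K * kappa <= (s * t) ^+ 2 ->
  fnorm2 W <= 4 + 4 * #|predC I|%:R + 4 * #|predC J|%:R
    + 16 * K / (s * t) ^+ 2 * (fnorm2 (A *m W - W *m A) + 16 * kappa)
    + 8 * m%:R / s ^+ 2 * (2 * fnorm2 (A *m W - W *m A) + 8 * kappa).
Proof.
move=> UU UU' ee symA We eW W4 WT4 OO OO' OA1 A1k Xk XE ff XK VV VV' O2O O2O' OA2
  symA2 A2k s0 HI t0 HJ kK.
pose A' := U *m A *m U^T; pose W' := U *m W *m U^T.
have symA' : A'^T = A' by rewrite /A' !trmx_mul trmxK symA mulmxA.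
have UTe p (M : 'M[R]_(m.+1, p)) : fnorm2 (U^T *m M) = fnorm2 M.
  by apply: fnorm2_isoml; rewrite trmxK.
have U_le p (M : 'M[R]_(m.+2, p)) : fnorm2 (U *m M) <= fnorm2 M.
  exact: fnorm2_coisoml_le.
have WUU : W *m (U^T *m U) = W by rewrite UU' mulmxBr mulmx1 mulmxA We mul0mx subr0.
have UUW : U^T *m U *m W = W by rewrite UU' mulmxBl mul1mx -mulmxA eW mulmx0 subr0.
have W'4 p (M : 'M[R]_(m.+1, p)) : fnorm2 (W' *m M) <= 4 * fnorm2 M.
  by rewrite /W' -!mulmxA (le_trans (U_le _ _))// (le_trans (W4 _ _))// UTe.
have W'T4 p (M : 'M[R]_(m.+1, p)) : fnorm2 (W'^T *m M) <= 4 * fnorm2 M.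
  rewrite /W' !trmx_mul trmxK -!mulmxA (le_trans (U_le _ _))//.
  by rewrite (le_trans (WT4 _ _))// UTe.
have fW : fnorm2 W = fnorm2 W'.
  have WE : W = U^T *m W' *m U by rewrite /W' !mulmxA UUW -mulmxA WUU.
  by rewrite {1}WE -mulmxA UTe -[X in _ *m X]trmxK fnorm2_isomr// trmxK.
have W'U : W' *m U = U *m W by rewrite /W' -!mulmxA WUU.
have UW' : U^T *m W' = W *m U^T by rewrite /W' !mulmxA UUW.
have comm : A' *m W' - W' *m A' = U *m (A *m W - W *m A) *m U^T.
  rewrite mulmxBr mulmxBl /A' -[U *m A *m _ *m _]mulmxA UW'.
  by rewrite ![W' *m _]mulmxA W'U !mulmxA.
(* As W e = 0, applying W' to U A e gives minus the compressed commutator applied to e. This makes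
   W' X small, which controls the last term of [mixed_basis_bound]. *)
have W'X : W' *m (U *m A *m e) = - (U *m ((A *m W - W *m A) *m e)).
  rewrite ![W' *m _]mulmxA W'U mulmxBl -[A *m W *m e]mulmxA We mulmx0 sub0r.
  by rewrite mulmxN opprK !mulmxA.
have e_le p (M : 'M[R]_(p, m.+2)) : fnorm2 (M *m e) <= fnorm2 M.
  by rewrite -[e]trmxK; apply: fnorm2_coisomr_le; rewrite trmxK.
set c := fnorm2 (A *m W - W *m A).
have comm_le : fnorm2 (A' *m W' - W' *m A') <= c.
  by rewrite comm (le_trans (fnorm2_coisomr_le _ UU))// U_le.
have W'Xc : fnorm2 (W' *m X) <= 2 * c + 8 * kappa.
  have -> : X = U *m A *m e - (U *m A *m e - X) by rewrite opprB addrC subrK.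
  rewrite mulmxBr (le_trans (fnorm2B_le _ _))// W'X fnorm2N.
  have := W'4 _ (U *m A *m e - X); have := U_le _ ((A *m W - W *m A) *m e).
  by have := e_le _ (A *m W - W *m A); rewrite -/c; lra.
pose Z := O2 *m V; pose x := (Z *m A' *m f)^T.
(* The two residuals are the rounding errors of A' and of V A' V^T, transported by O, V and O2. *)
have bound := @mixed_basis_bound R m A' W' O Z f X mu nu x (O *m (A' - A1))
  (V^T *m (V *m A' *m V^T - A2) *m O2^T) xi K s t kappa I J.
rewrite fW (le_trans (bound _ _ _ _ _ _ _ _ _ _ _ _ _ _ _ _ _ _))// {bound}.
- by rewrite /Z trmx_mul -mulmxA [V *m _]mulmxA VV mul1mx.
- by rewrite /Z trmx_mul -mulmxA [ O2^T *m _]mulmxA O2O' mul1mx.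
- by rewrite mulmxBr OA1 addrC subrK.
- have OA2' : A2 *m O2^T = O2^T *m diag_mx nu.
    by rewrite -{1}symA2 -trmx_mul OA2 trmx_mul tr_diag_mx.
  have -> : Z^T *m diag_mx nu = V^T *m A2 *m O2^T.
    by rewrite /Z trmx_mul -!mulmxA OA2'.
  rewrite mulmxBr mulmxBl addrC addrA subrK.
  have -> : x = f^T *m A' *m Z^T by rewrite -{1}symA' -mulmxA -!trmx_mul.
  rewrite [f *m _]mulmxA [f *m _]mulmxA.
  rewrite /Z [(O2 *m V)^T]trmx_mul !mulmxA -!mulmxDl VV'.
  by rewrite subrK mul1mx.
- by rewrite fnorm2_isoml.
- rewrite (le_trans (fnorm2_coisomr_le _ O2O))//.
  by rewrite fnorm2_isoml// trmxK.
- have <- : fnorm2 X = xi ^+ 2; last by [].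
  by rewrite XE fnorm2Z -fnorm2_tr fnorm2E trmxK ff mxtrace1 mulr1.
- by move=> j /HJ; rewrite [x 0 j]mxE.
have c1 : 0 <= 16 * K / (s * t) ^+ 2.
  by rewrite !mulr_ge0 ?invr_ge0 ?sqr_ge0// (le_trans (fnorm2_ge0 X)).
have c2 : 0 <= 8 * m%:R / s ^+ 2 by rewrite !mulr_ge0 ?invr_ge0 ?sqr_ge0.
by rewrite lerD// ?lerD// ler_wpM2l// lerD2r.
Qed.

End two_step_compression.

(** * Doubly stochastic matrices and the minimizer *)

Section doubly_stochastic.
Context {R : realType}.

Lemma frobenius_norm_sqr m n (M : 'M[R]_(m, n)) :
  frobenius_norm M ^+ 2 = fnorm2 M.
Proof. by rewrite sqr_sqrtr// fnorm2_ge0. Qed.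

Lemma birkhoff_tr n (Y : 'M[R]_n) : birkhoff n Y -> birkhoff n Y^T.
Proof.
move=> [Y0 Yr Yc]; split=> [i j|i|j]; first by rewrite mxE.
  by under eq_bigr do rewrite mxE.
by under eq_bigr do rewrite mxE.
Qed.

(** Each row of Y is a probability vector, so by Jensen the square of an entry of Y M is at most the
    average of the squares. After summation the column sums of Y restore |M|_F^2. *)
Lemma birkhoff_contraction n p (Y : 'M[R]_n) (M : 'M[R]_(n, p)) :
  birkhoff n Y -> fnorm2 (Y *m M) <= fnorm2 M.
Proof.
move=> [Y0 Yr Yc].
apply: (@le_trans _ _ (\sum_i \sum_j \sum_k Y i k * M k j ^+ 2)).
  apply: ler_sum => i _; apply: ler_sum => j _; rewrite mxE.
  set a := \sum_k _.
  (* This is the variance of the j-th column of M under the weights Y_ik. *)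
  have : 0 <= \sum_k Y i k * (M k j - a) ^+ 2.
    by apply: sumr_ge0 => k _; rewrite mulr_ge0// sqr_ge0.
  have -> : \sum_k Y i k * (M k j - a) ^+ 2 =
      \sum_k Y i k * M k j ^+ 2 - 2 * a * a + a ^+ 2 * \sum_k Y i k.
    have -> : 2 * a * a = 2 * a * \sum_k Y i k * M k j by [].
    rewrite [2 * a * _]mulr_sumr -sumrB [a ^+ 2 * _]mulr_sumr -big_split/=.
    by apply: eq_bigr => k _; ring.
  by rewrite Yr => h; rewrite -subr_ge0; nra.
rewrite /fnorm2; under eq_bigr do rewrite exchange_big/=.
rewrite exchange_big/=; apply: ler_sum => k _.
rewrite exchange_big/=; apply: ler_sum => j _.
by rewrite -mulr_suml Yc mul1r.
Qed.

Lemma one_sub_birkhoff_contraction n p (Y : 'M[R]_n) (M : 'M[R]_(n, p)) :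
  birkhoff n Y -> fnorm2 ((1%:M - Y) *m M) <= 4 * fnorm2 M.
Proof.
move=> bY; rewrite mulmxBl mul1mx (le_trans (fnorm2B_le _ _))//.
by have := birkhoff_contraction M bY; lra.
Qed.

Lemma birkhoff_perm n (s : {perm 'I_n}) : birkhoff n (perm_mx s : 'M[R]_n).
Proof.
split=> [i j|i|j]; first by rewrite !mxE ler0n.
  rewrite (bigD1 (s i))//= !mxE eqxx big1 ?addr0// => j ji.
  by rewrite !mxE eq_sym (negbTE ji).
rewrite (bigD1 ((s^-1)%g j))//= !mxE permKV eqxx big1 ?addr0// => i ij.
by rewrite !mxE -(inj_eq (@perm_inj _ (s^-1)%g)) permK (negbTE ij).
Qed.

Lemma birkhoff_colperm n (s : {perm 'I_n}) (X : 'M[R]_n) :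
  birkhoff n X -> birkhoff n (\matrix_(i, j) X i (s j)).
Proof.
move=> [X0 Xr Xc]; split=> [i j|i|j]; first by rewrite mxE.
  under eq_bigr do rewrite mxE.
  by rewrite -(Xr i) [RHS](reindex_inj (@perm_inj _ s)).
by under eq_bigr do rewrite mxE.
Qed.

(** After relabelling columns by pi, the objective is |A Y - Y (A + sigma Z)|_F^2 at X and sigma^2
    |Z|_F^2 at the permutation matrix of pi. Up to sign, the commutator with 1 - Y is the first
    matrix plus Y (sigma Z), and Y is a contraction; each of these two terms contributes 2 sigma^2
    |Z|_F^2. *)
Lemma minimizer_commutator n (A B Z X Y : 'M[R]_n) (pi : {perm 'I_n}) (sigma : R) :
  (forall i j, B (pi i) (pi j) = A i j + sigma * Z i j) ->
  argmin (birkhoff n) (fun X => frobenius_norm (A *m X - X *m B) ^+ 2) X ->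
  Y = \matrix_(i, j) X i (pi j) ->
  fnorm2 (A *m (1%:M - Y) - (1%:M - Y) *m A) <= 4 * sigma ^+ 2 * fnorm2 Z.
Proof.
move=> BE [bX minX] YE.
have bY : birkhoff n Y by rewrite YE; exact: birkhoff_colperm.
have perm_fnorm2 (M N : 'M[R]_n) : (forall i j, M i (pi j) = N i j) ->
    fnorm2 M = fnorm2 N.
  move=> MN; apply: eq_bigr => i _.
  by rewrite (reindex_inj (@perm_inj _ pi)); apply: eq_bigr => j _; rewrite MN.
have fX : fnorm2 (A *m X - X *m B) = fnorm2 (A *m Y - Y *m (A + sigma *: Z)).
  apply: perm_fnorm2 => i j; rewrite !mxE; congr (_ - _).
    by apply: eq_bigr => k _; rewrite YE !mxE.
  rewrite (reindex_inj (@perm_inj _ pi)); apply: eq_bigr => k _.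
  by rewrite BE YE !mxE.
have fP : fnorm2 (A *m perm_mx pi - perm_mx pi *m B) = sigma ^+ 2 * fnorm2 Z.
  rewrite -(fnorm2Z sigma) -fnorm2N; apply: perm_fnorm2 => i j.
  rewrite -row_permE !mxE (bigD1 j)//= big1 => [|k kj].
    by rewrite !mxE eqxx BE mulr1 addr0 opprB addrC addKr.
  by rewrite !mxE (inj_eq perm_inj) (negbTE kj) mulr0.
have := minX _ (birkhoff_perm pi); rewrite !frobenius_norm_sqr fX fP => le1.
have -> : A *m (1%:M - Y) - (1%:M - Y) *m A =
    - (A *m Y - Y *m (A + sigma *: Z)) - Y *m (sigma *: Z).
  rewrite mulmxBr mulmxBl mulmx1 mul1mx mulmxDr !opprB.
  by rewrite [LHS]addrC subrKA [RHS]addrAC addrK.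
rewrite (le_trans (fnorm2B_le _ _))// fnorm2N.
have := birkhoff_contraction (sigma *: Z) bY; rewrite fnorm2Z => le2.
by lra.
Qed.

(** At an error, pi i and pihat i are distinct columns and X is at least as large at pihat i, so
    X_{i, pi i} <= 1 / 2. The i-th diagonal entry on the right is then at least 1 / 2, whence the
    factor 4. *)
Lemma errors_le_fnorm2 n (X : 'M[R]_n) (pi : {perm 'I_n}) (pihat : 'I_n -> 'I_n) :
  birkhoff n X ->
  (forall i, argmax [set: 'I_n] (fun j => X i j) (pihat i)) ->
  (\sum_(i < n) (pihat i != pi i : nat))%N%:R <=
  4 * fnorm2 (1%:M - \matrix_(i, j) X i (pi j)).
Proof.
move=> [X0 Xr Xc] maxX; rewrite natr_sum mulr_sumr; apply: ler_sum => i _.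
case: eqP => [_|/eqP ne]; first by rewrite mulr_ge0// sumr_ge0// => j _; exact: sqr_ge0.
rewrite (bigD1 i)//= !mxE eqxx mulr1n.
have le0 : 0 <= \sum_(j < n | j != i) (1%:M - \matrix_(i, j) X i (pi j)) i j ^+ 2.
  by apply: sumr_ge0 => j _; exact: sqr_ge0.
have le1 : X i (pi i) <= X i (pihat i) by have [_] := maxX i; apply.
have : X i (pi i) + X i (pihat i) <= 1.
  rewrite -(Xr i) (bigD1 (pi i))//= (bigD1 (pihat i))//= addrA lerDl.
  by apply: sumr_ge0.
have := X0 i (pi i); set y := X i (pi i) in le1 *; nra.
Qed.

End doubly_stochastic.

(** The pushforward is packaged with its measure structure so that uniqueness theorems for measures
    apply to it. *)
Definition image_measure d1 d2 (T1 : measurableType d1) (T2 : measurableType d2)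
    (R : realType) (mu : {measure set T1 -> \bar R}) (f : T1 -> T2)
    (mf : measurable_fun setT f) : {measure set T2 -> \bar R} :=
  measure_function_pushforward__canonical__measure_function_Measure mu mf.

(** * Cameron-Martin formula for independent Gaussians *)

Section normal_shift.
Context {R : realType}.
Local Notation leb := (@lebesgue_measure R).

(** Lebesgue measure and its translate agree on half-open intervals, hence on all measurable
    sets. *)
Lemma ge0_integral_lebesgue_shift (f : R -> \bar R) (h : R) :
  measurable_fun setT f -> (forall x, 0 <= f x)%E ->
  (\int[leb]_x f (x + h)%R = \int[leb]_x f x)%E.
Proof.
move=> mf f0.
have mh : measurable_fun [set: measurableTypeR R] (fun x : R => x + h : measurableTypeR R).
  exact: measurable_funD.
have shiftE A : measurable A -> leb A = pushforward leb (fun x : R => x + h) A.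
  move=> mA.
  apply: (@lebesgue_measure_unique R (image_measure leb mh)) => //.
  move=> _ [[a b] _ <-].
  rewrite [RHS](_ : _ = leb `](a - h), (b - h)]); last first.
    rewrite /image_measure/= /pushforward; congr (leb _).
    by apply/seteqP; split => x /=; rewrite !in_itv/= ltrBlDr lerBrDr.
  rewrite !lebesgue_measure_itv/= !lte_fin ltrD2r.
  by case: ifP => // _; rewrite -!EFinB opprB addrA subrK.
transitivity (\int[pushforward leb 
    (fun x : measurableTypeR R => (x + h)%R : measurableTypeR R)]_x f x)%E.
  by rewrite (ge0_integral_pushforward mh leb).
apply: (@eq_measure_integral _ _ _ setT leb (image_measure leb mh)) => A mA _.
exact/esym/shiftE.
Qed.

(** The Radon-Nikodym derivative and [normal_pdf] have the same integral over every measurable set,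
    so they agree almost everywhere. *)
Lemma ge0_integral_normal_prob (s : R) (f : R -> \bar R) : s != 0 ->
  measurable_fun setT f -> (forall x, 0 <= f x)%E ->
  (\int[normal_prob 0 s]_x f x = \int[leb]_x (f x * (normal_pdf 0 s x)%:E))%E.
Proof.
move=> s0 mf f0.
have dom := normal_prob_dominates 0 s.
rewrite -(Radon_Nikodym_SigmaFinite.change_of_variables dom)//.
have RNi := Radon_Nikodym_SigmaFinite.f_integrable dom.
have mpdf : measurable_fun [set: R] (fun x => (normal_pdf 0 s x)%:E).
  by apply/measurable_EFinP; exact: measurable_normal_pdf.
apply: ae_eq_integral => //.
- by apply: emeasurable_funM => //; exact: measurable_int RNi.
- exact: emeasurable_funM.
- apply: ae_eqe_mul2l; apply: integral_ae_eq => //.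
  move=> E _ mE.
  by rewrite -(Radon_Nikodym_SigmaFinite.f_integral dom).
Qed.

(** The density of N(h, v) with respect to N(0, v). *)
Definition shift_density (v h y : R) : R := expR (h * y / v - h ^+ 2 / (2 * v)).

Lemma measurable_shift_density v h : measurable_fun setT (shift_density v h).
Proof.
apply: measurableT_comp => //; apply: measurable_funB => //.
by apply: measurable_funM => //; exact: measurable_funM.
Qed.

(** Translating the variable moves the Gaussian density to x - h; expanding the square, its quotient
    by the density at x is [shift_density]. *)
Lemma normal_prob_shift (v h : R) (f : R -> \bar R) : 0 < v ->
  measurable_fun setT f -> (forall x, 0 <= f x)%E ->
  (\int[normal_prob 0 (Num.sqrt v)]_x f (x + h)%R =
   \int[normal_prob 0 (Num.sqrt v)]_x (f x * (shift_density v h x)%:E))%E.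
Proof.
move=> v0 mf f0.
have s0 : Num.sqrt v != 0 by rewrite sqrtr_eq0 -ltNge.
have msh : measurable_fun [set: R] (fun x : R => x + h) by exact: measurable_funD.
have mpdf c : measurable_fun [set: R] (fun x => (normal_pdf 0 (Num.sqrt v) (x - c))%:E).
  apply/measurable_EFinP; apply: measurableT_comp => //; first exact: measurable_normal_pdf.
  exact: measurable_funB.
rewrite ge0_integral_normal_prob//; last exact: measurableT_comp msh.
rewrite ge0_integral_normal_prob//; last 2 first.
- apply: emeasurable_funM => //; apply/measurable_EFinP.
  exact: measurable_shift_density.
- by move=> x; rewrite mule_ge0// lee_fin expR_ge0.
pose G x := (f x * (normal_pdf 0 (Num.sqrt v) (x - h)%R)%:E)%E.
transitivity (\int[leb]_x G (x + h)%R)%E.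
  by apply: eq_integral => x _; rewrite /G addrK.
rewrite ge0_integral_lebesgue_shift//; last 2 first.
- exact: emeasurable_funM.
- by move=> x; rewrite mule_ge0// lee_fin normal_pdf_ge0.
apply: eq_integral => x _; rewrite /G -muleA; congr (_ * _)%E; rewrite -EFinM; congr EFin.
rewrite /shift_density !normal_pdfE// mulrCA; congr (_ * _).
rewrite /normal_fun -expRD sqr_sqrtr ?ltW// !subr0 -mulr_natr; congr expR.
by field; rewrite gt_eqF.
Qed.

End normal_shift.

Section coordinate_law.
Context {R : realType} {I : finType} (D : {pred I}).

(** Only coordinates in D are constrained, since independence is assumed for these alone. The
    rectangles form a pi-system. *)
Definition coordinate_rectangles : set (set (I -> R)) :=
  [set S | exists2 U : I -> set R, (forall i, measurable (U i)) &
     S = [set x | forall i, i \in D -> U i (x i)]].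

Local Notation cT := (g_sigma_algebraType coordinate_rectangles).

Lemma measurable_coordinate i : i \in D -> measurable_fun [set: cT] (fun x : cT => x i).
Proof.
move=> iD _ V mV; rewrite setTI; apply: sub_sigma_algebra.
exists (fun j => if j == i then V else setT); first by move=> j; case: ifP.
apply/seteqP; split=> [x /= Vx j jD|x /= /(_ i iD)]; last by rewrite eqxx.
by case: eqP => // ->.
Qed.

Lemma measurable_to_coordinates d (T : measurableType d) (f : T -> cT) :
  (forall i, i \in D -> measurable_fun setT (fun w => f w i)) ->
  measurable_fun setT f.
Proof.
move=> mf; apply: measurability => //.
move=> _ [_ [U mU ->] <-]; rewrite setTI.
have -> : f @^-1` [set x | forall i, i \in D -> U i (x i)] =
    \bigcap_(i in [set` D]) ((fun w => f w i) @^-1` U i).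
  by apply/seteqP; split.
apply: fin_bigcap_measurable => [|i iD]; first exact: finite_finset.
by rewrite -[X in measurable X]setTI; exact: mf.
Qed.

Definition replace (k : I) (p : measurableTypeR R * cT) : cT :=
  fun i => if i == k then p.1 else p.2 i.

Lemma measurable_replace k : measurable_fun [set: (measurableTypeR R * cT)%type] (replace k).
Proof.
apply: measurable_to_coordinates => i iD; rewrite /replace.
case: eqP => _; first exact: measurable_fst.
by apply: (measurableT_comp (measurable_coordinate iD)); exact: measurable_snd.
Qed.

End coordinate_law.

Section cameron_martin.
Context {d} {T : measurableType d} {R : realType} (P : probability T R).
Context {I : finType} (D : {pred I}) (X : I -> T -> R) (v : I -> R).
Hypothesis mX : forall i, i \in D -> measurable_fun setT (X i).
Hypothesis indepX : mutually_independent P D X.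
Hypothesis lawX : forall i, i \in D -> normal_law P (X i) (v i).
Hypothesis v0 : forall i, i \in D -> 0 < v i.

Local Notation cT := (g_sigma_algebraType (@coordinate_rectangles R I D)).

Definition coordinates : T -> cT := fun w i => X i w.

Lemma measurable_coordinates : measurable_fun setT coordinates.
Proof. exact: measurable_to_coordinates. Qed.

HB.instance Definition _ :=
  isMeasurableFun.Build _ _ _ _ coordinates measurable_coordinates.

Local Notation mu := (distribution P coordinates).

Lemma distribution_rectangle (U : I -> set R) : (forall i, measurable (U i)) ->
  mu [set x | forall i, i \in D -> U i (x i)] =
  (\prod_(i in D) P (X i @^-1` U i))%E.
Proof.
move=> mU; have := @indepX [set i in D]%SET _ U mU.
under eq_bigl do rewrite inE.
move=> <-; last by apply/fintype.subsetP => i; rewrite inE.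
congr (P _); apply/seteqP; split => w /=.
  by move=> Uw i; rewrite /= inE; exact: Uw.
by move=> Uw i iD; apply: Uw; rewrite /= inE.
Qed.

(** Resampling coordinate k from its own law, independently of the rest, preserves the joint law. In
    this form independence lets Fubini isolate one coordinate. Both sides are the same product on
    rectangles, a generating pi-system. *)
Lemma replace_distribution k S : k \in D -> measurable S ->
  mu S = (normal_prob 0 (Num.sqrt (v k)) \x mu)%E (@replace R I D k @^-1` S).
Proof.
move=> kD mS.
pose nu := image_measure (normal_prob 0 (Num.sqrt (v k)) \x mu)%E
  (@measurable_replace R I D k).
change (mu S = nu S).
apply: (@measure_unique _ R cT (@coordinate_rectangles R I D) (fun=> setT)
  _ _ _ _ mu nu _ _ S mS) => //.
- move=> _ _ [U1 mU1 ->] [U2 mU2 ->].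
  exists (fun i => U1 i `&` U2 i) => [i|]; first exact: measurableI.
  apply/seteqP; split => x /=; first by move=> [x1 x2] i iD; split; [exact: x1|exact: x2].
  by move=> x12; split => i iD; have [] := x12 i iD.
- move=> _; exists (fun=> setT) => //; exact/seteqP.
- by rewrite bigcup_const.
- move=> _ [U mU ->].
  rewrite [LHS](distribution_rectangle mU).
  have -> : nu [set x | forall i, i \in D -> U i (x i)] =
      (normal_prob 0 (Num.sqrt (v k)) \x mu)%E
        (U k `*` [set x : cT | forall i, i \in D ->
           (if i == k then setT else U i) (x i)]).
    rewrite /nu /image_measure/= /pushforward; congr (_ _).
    apply/seteqP; split => [[y x] /= Uyx|[y x] /= [Uy Ux] i iD].
      split; first by have := Uyx k kD; rewrite /replace eqxx.
      by move=> i iD; have := Uyx i iD; rewrite /replace; case: eqP.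
    by have := Ux i iD; rewrite /replace; case: eqP => // ->.
  rewrite product_measure1E; [|exact: mU|]; last first.
    apply: sub_sigma_algebra; exists (fun i => if i == k then setT else U i) => //.
    by move=> i; case: ifP.
  (* V drops the constraint on coordinate k, which the Gaussian factor accounts for. *)
  pose V i := if i == k then setT else U i.
  have mV i : measurable (V i) by rewrite /V; case: ifP.
  rewrite [X in (_ * X)%E](_ : _ = \prod_(i in D) P (X i @^-1` V i))%E; last first.
    exact: distribution_rectangle mV.
  have PVk : P (X k @^-1` V k) = 1%E.
    by rewrite /V eqxx preimage_setT; exact: probability_setT.
  rewrite (bigD1 k)//= [in RHS](bigD1 k)//= PVk mul1e -(lawX kD)//; congr (_ * _)%E.
  by apply: eq_bigr => i /andP[_ ik]; rewrite /V (negbTE ik).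
- move=> _; rewrite [X in (X < _)%E](_ : _ = 1%E) ?ltry//.
  exact: (@probability_setT _ _ _ mu).
Qed.

Lemma integral_replace k (f : cT -> \bar R) : k \in D ->
  measurable_fun setT f -> (forall x, 0 <= f x)%E ->
  (\int[mu]_x f x =
   \int[mu]_x \int[normal_prob 0 (Num.sqrt (v k))]_y f (@replace R I D k (y, x)))%E.
Proof.
move=> kD mf f0.
pose nu := image_measure (normal_prob 0 (Num.sqrt (v k)) \x mu)%E
  (@measurable_replace R I D k).
transitivity (\int[pushforward (normal_prob 0 (Num.sqrt (v k)) \x mu)%E
    (@replace R I D k)]_x f x)%E.
  apply: (@eq_measure_integral _ _ _ setT nu mu) => S mS _.
  exact: replace_distribution.
transitivity (\int[(normal_prob 0 (Num.sqrt (v k)) \x mu)%E]_z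
    (f \o (@replace R I D k)) z)%E.
  have := ge0_integral_pushforward (@measurable_replace R I D k)
    (normal_prob 0 (Num.sqrt (v k)) \x mu)%E measurableT mf.
  rewrite preimage_setT; apply=> x _; exact: f0.
apply: (fubini_tonelli2 (f \o (@replace R I D k))) => [|x]; last exact: f0.
exact: measurableT_comp (@measurable_replace R I D k).
Qed.

Definition shift_coordinates (s : {pred I}) (a : I -> R) (x : cT) : cT :=
  fun i => if i \in s then x i + a i else x i.

Lemma measurable_shift_coordinates s a :
  measurable_fun setT (shift_coordinates s a).
Proof.
apply: measurable_to_coordinates => i iD; rewrite /shift_coordinates.
case: (i \in s); last exact: measurable_coordinate.
by apply: measurable_funD => //; exact: measurable_coordinate.
Qed.

Lemma measurable_coordinate_density k h : k \in D ->
  measurable_fun [set: cT] (fun x : cT => (shift_density (v k) h (x k))%:E).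
Proof.
move=> kD; apply/measurable_EFinP; apply: measurableT_comp (measurable_coordinate kD).
exact: measurable_shift_density.
Qed.

(** By resampling, coordinate k is integrated in an inner integral, to which the one-dimensional
    shift applies. *)
Lemma cameron_martin1 k a (f : cT -> \bar R) : k \in D ->
  measurable_fun setT f -> (forall x, 0 <= f x)%E ->
  (\int[mu]_x f (shift_coordinates (pred1 k) a x) =
   \int[mu]_x (f x * (shift_density (v k) (a k) (x k))%:E))%E.
Proof.
move=> kD mf f0; rewrite (integral_replace kD)//; last first.
  exact: measurableT_comp (measurable_shift_coordinates _ _).
rewrite [RHS](integral_replace kD)//; last 2 first.
- by apply: emeasurable_funM => //; exact: measurable_coordinate_density.
- by move=> x; rewrite mule_ge0// lee_fin expR_ge0.
apply: eq_integral => x _.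
have mrep : measurable_fun setT (fun y : R => f (@replace R I D k (y, x))).
  apply: (measurableT_comp mf).
  apply: (measurableT_comp (@measurable_replace R I D k)).
  exact: measurable_pair2.
rewrite [RHS](eq_integral (fun y => f (@replace R I D k (y, x)) *
  (shift_density (v k) (a k) y)%:E)%E); last first.
  by move=> y _; rewrite {2}/replace eqxx.
rewrite -(normal_prob_shift (a k) (v0 kD) mrep)//.
apply: eq_integral => y _; congr (f _); apply/funext => i.
by rewrite /shift_coordinates /replace inE; case: eqP => // ->.
Qed.

(** Induction on the list of shifted coordinates. The density factors of the tail are unaffected by
    the shift of the head because the list has no repetition. *)
Lemma cameron_martin_seq (s : seq I) a (f : cT -> \bar R) : uniq s ->
  {subset s <= D} -> measurable_fun setT f -> (forall x, 0 <= f x)%E ->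
  (\int[mu]_x f (shift_coordinates (mem s) a x) =
   \int[mu]_x (f x * (\prod_(i <- s) shift_density (v i) (a i) (x i))%:E))%E.
Proof.
elim: s f => [|k s IH] f /=; first by under [in RHS]eq_integral do rewrite big_nil mule1.
move=> /andP[ks us] sD mf f0.
have kD : k \in D by apply: sD; rewrite mem_head.
have {}sD : {subset s <= D} by move=> i si; apply: sD; rewrite inE si orbT.
have mprod : measurable_fun [set: cT]
    (fun x : cT => (\prod_(i <- s) shift_density (v i) (a i) (x i))%:E).
  apply/measurable_EFinP; apply: measurable_prod => i si.
  by apply/measurable_EFinP; apply: measurable_coordinate_density; exact: sD.
have prod0 (x : cT) : (0 <= (\prod_(i <- s) shift_density (v i) (a i) (x i))%:E)%E.
  by rewrite lee_fin prodr_ge0// => i _; exact: expR_ge0.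
transitivity (\int[mu]_x f (shift_coordinates (pred1 k) a (shift_coordinates (mem s) a x)))%E.
  apply: eq_integral => x _; congr (f _); apply/funext => i.
  rewrite /shift_coordinates !inE; case: eqP => //= ->.
  by rewrite (negbTE ks).
have mfs : measurable_fun setT (f \o shift_coordinates (pred1 k) a).
  exact: measurableT_comp (measurable_shift_coordinates _ _).
rewrite (IH (f \o shift_coordinates (pred1 k) a) us sD mfs)//; last first.
  by move=> x; exact: f0.
pose g (x : cT) := (f x * (\prod_(i <- s) shift_density (v i) (a i) (x i))%:E)%E.
transitivity (\int[mu]_x g (shift_coordinates (pred1 k) a x))%E.
  apply: eq_integral => x _; rewrite /g/=; congr (_ * _%:E)%E.
  apply: eq_big_seq => i si; rewrite /shift_coordinates inE.
  by case: eqP si => // ->; rewrite (negbTE ks).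
rewrite cameron_martin1//; last 2 first.
- exact: emeasurable_funM.
- by move=> x; rewrite mule_ge0.
by apply: eq_integral => x _; rewrite /g -muleA -EFinM big_cons mulrC.
Qed.

Lemma cameron_martin a (f : cT -> \bar R) :
  measurable_fun setT f -> (forall x, 0 <= f x)%E ->
  (\int[P]_w f (shift_coordinates D a (coordinates w)) =
   \int[P]_w (f (coordinates w) * (expR (\sum_(i in D)
      (a i * X i w / v i - a i ^+ 2 / (2 * v i))))%:E))%E.
Proof.
move=> mf f0.
have sD : {subset enum D <= D} by move=> i; rewrite mem_enum.
pose g (x : cT) := (f x * (\prod_(i <- enum D) shift_density (v i) (a i) (x i))%:E)%E.
transitivity (\int[mu]_x f (shift_coordinates D a x))%E.
  rewrite (ge0_integral_distribution _ (f := f \o shift_coordinates D a))// => [|x].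
    exact: measurableT_comp (measurable_shift_coordinates _ _).
  exact: f0.
transitivity (\int[mu]_x g x)%E.
  rewrite -(@cameron_martin_seq (enum D) a f (enum_uniq _) sD mf f0).
  apply: eq_integral => x _; congr (f _); apply/funext => i.
  by rewrite /shift_coordinates [RHS]/= mem_enum.
have mg : measurable_fun setT g.
  apply: emeasurable_funM => //; apply/measurable_EFinP; apply: measurable_prod => i si.
  by apply/measurable_EFinP; apply: measurable_coordinate_density; exact: sD.
have g0 x : (0 <= g x)%E.
  by rewrite mule_ge0// lee_fin prodr_ge0// => i _; exact: expR_ge0.
rewrite (ge0_integral_distribution _ mg g0).
apply: eq_integral => w _; rewrite /g/= big_enum/=; congr (_ * _%:E)%E.
by rewrite expR_sum.
Qed.

End cameron_martin.

(** * Small-ball bounds for the GOE *)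

Section markov_counting.
Context {d} {T : measurableType d} {R : realType} (P : probability T R).

Lemma markov_ge0 (f : T -> \bar R) (a : R) (c : \bar R) : 0 <= a ->
  measurable_fun setT f -> (forall w, 0 <= f w)%E -> (\int[P]_w f w <= c)%E ->
  (a%:E * P [set w | (a%:E <= f w)%E] <= c)%E.
Proof.
move=> a0 mf f0; apply: le_trans.
have mE : measurable [set w | (a%:E <= f w)%E].
  by rewrite -[X in measurable X]setTI; exact: emeasurable_fun_c_infty.
set E := [set w | _] in mE *.
have <- : (\int[P]_w (\1_E w)%:E = P E)%E by rewrite integral_indic// setIT.
rewrite -ge0_integralZl_EFin//; last by apply/measurable_EFinP; exact: measurable_indic.
apply: ge0_le_integral => //.
- by move=> w _; rewrite mule_ge0 ?lee_fin.
- by apply: emeasurable_funM => //; apply/measurable_EFinP; exact: measurable_indic.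
move=> w _; rewrite indicE; have [|_] := boolP (w \in E); last by rewrite mule0.
by rewrite inE mule1.
Qed.

Lemma markov_count n (B : 'I_n -> set T) (p a : R) : 0 <= a ->
  (forall i, measurable (B i)) -> (forall i, P (B i) <= p%:E)%E ->
  (a%:E * P [set w | (a <= \sum_i \1_(B i) w)%R] <= (n%:R * p)%:E)%E.
Proof.
move=> a0 mB Bp.
have mi i : measurable_fun setT (fun w => (\1_(B i) w)%:E : \bar R).
  by apply/measurable_EFinP; exact: measurable_indic.
have -> : [set w | a <= \sum_i \1_(B i) w] =
    [set w | (a%:E <= \sum_i (\1_(B i) w)%:E)%E].
  by apply/seteqP; split => w /=; rewrite sumEFin lee_fin.
apply: markov_ge0 => //.
- by apply: emeasurable_sum => i.
- by move=> w; apply: sume_ge0 => i _; rewrite lee_fin.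
rewrite ge0_integral_sum//.
rewrite mulrC -[X in (_ * X%:R)%R]card_ord mulr_natr -sumr_const -sumEFin.
by apply: lee_sum => i _; rewrite integral_indic// setIT; exact: Bp.
Qed.

End markov_counting.

Section goe.
Context {d} {T : measurableType d} {R : realType} (P : probability T R).
Context {n : nat} (A : T -> 'M[R]_n).
Hypothesis n0 : (0 < n)%N.
Hypothesis goeA : GOE P A.

Local Notation D := [pred ij : 'I_n * 'I_n | (ij.1 <= ij.2)%N].
Local Notation cT := (g_sigma_algebraType (@coordinate_rectangles R _ D)).

Definition entry (ij : 'I_n * 'I_n) (w : T) : R := A w ij.1 ij.2.
Definition variance (ij : 'I_n * 'I_n) : R :=
  if ij.1 == ij.2 then 2 / n%:R else 1 / n%:R.

Let nR0 : 0 < n%:R :> R. Proof. by rewrite ltr0n. Qed.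

Let mentry ij : ij \in D -> measurable_fun setT (entry ij).
Proof. by move=> _; exact: (GOE_measurable goeA). Qed.

Let lawentry ij : ij \in D -> normal_law P (entry ij) (variance ij).
Proof.
case: ij => i j _; rewrite /entry /variance/=; case: eqVneq => [->|ij].
  exact: (GOE_diag goeA).
exact: (GOE_offdiag goeA).
Qed.

Let variance0 ij : ij \in D -> 0 < variance ij.
Proof. by move=> _; rewrite /variance; case: ifP => _; rewrite divr_gt0. Qed.

(** [GOE] gives independence for i <= j only, so a symmetric matrix is rebuilt from its upper
    triangle. *)
Definition of_upper (x : 'I_n * 'I_n -> R) : 'M[R]_n :=
  \matrix_(i, j) if (i <= j)%N then x (i, j) else x (j, i).

Let upper w : cT := fun ij => entry ij w.

Lemma of_upper_entry w : of_upper (upper w) = A w.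
Proof.
apply/matrixP => i j; rewrite mxE /upper /entry; case: ifP => //= _.
exact: (GOE_symmetric goeA).
Qed.

Lemma measurable_of_upper i j : measurable_fun setT (fun x : cT => of_upper x i j).
Proof.
have [ij|/ltnW ji] := leqP i j.
  have -> : (fun x : cT => of_upper x i j) = (fun x => x (i, j)).
    by apply/funext => x; rewrite mxE ij.
  exact: (@measurable_coordinate R _ D (i, j)).
have -> : (fun x : cT => of_upper x i j) = (fun x => x (j, i)).
  apply/funext => x; rewrite mxE; case: ifPn => // ij.
  by have -> : i = j by apply/val_inj/eqP; rewrite eqn_leq ij ji.
exact: (@measurable_coordinate R _ D (j, i)).
Qed.

Definition mx_dot (M N : 'M[R]_n) : R := \sum_i \sum_j M i j * N i j.

(** The diagonal variance is twice the off-diagonal one, while an off-diagonal entry occurs twice in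
    the full sum: every entry gets the same weight n / 2. *)
Lemma sum_upper (F : 'I_n -> 'I_n -> R) : (forall i j, F i j = F j i) ->
  \sum_(ij in D) F ij.1 ij.2 / variance ij = n%:R / 2 * \sum_i \sum_j F i j.
Proof.
move=> symF.
transitivity (\sum_(ij : 'I_n * 'I_n) n%:R / 2 * F ij.1 ij.2); last first.
  by rewrite pair_bigA/= mulr_sumr.
rewrite [RHS](bigID D)/=.
have -> : \sum_(ij : 'I_n * 'I_n | ~~ (ij.1 <= ij.2)%N) n%:R / 2 * F ij.1 ij.2 =
    \sum_(ij : 'I_n * 'I_n | (ij.1 <= ij.2)%N)
      (if ij.1 != ij.2 then n%:R / 2 * F ij.1 ij.2 else 0).
  have swapI : injective (fun p : 'I_n * 'I_n => (p.2, p.1)).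
    by move=> [? ?] [? ?] [-> ->].
  rewrite -big_mkcondr/= (reindex_inj swapI)/=.
  apply: eq_big => [[i j]|[i j] _]/=; last by rewrite symF.
  by rewrite -ltnNge ltn_neqAle andbC (inj_eq val_inj).
rewrite -big_split/=; apply: eq_bigr => -[i j] _; rewrite /variance/=.
by case: (eqVneq i j) => _ /=; field; rewrite gt_eqF.
Qed.

Lemma of_upper_shift M w : M^T = M ->
  of_upper (shift_coordinates D (fun ij => M ij.1 ij.2) (upper w)) = A w + M.
Proof.
move=> symM; have symMij i j : M i j = M j i by rewrite -{1}symM mxE.
apply/matrixP => i j; rewrite -of_upper_entry !mxE /shift_coordinates.
case: ifPn => ij; first by rewrite inE/= ij.
have ji : (j <= i)%N by rewrite ltnW// ltnNge.
by rewrite inE/= ji symMij.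
Qed.

(** The exponent is that of a density proportional to exp (- n |A|_F^2 / 4) on symmetric matrices;
    [sum_upper] turns the sum over the triangle into sums over all entries. *)
Lemma goe_cameron_martin (M : 'M[R]_n) (f : 'M[R]_n -> \bar R) : M^T = M ->
  measurable_fun setT (fun x : cT => f (of_upper x)) -> (forall N, 0 <= f N)%E ->
  (\int[P]_w f (A w + M)%R = \int[P]_w (f (A w) *
     (expR (n%:R / 2 * mx_dot (A w) M - n%:R / 4 * fnorm2 M))%:E))%E.
Proof.
move=> symM mf f0.
have symMij i j : M i j = M j i by rewrite -{1}symM mxE.
have := cameron_martin mentry (GOE_independent goeA) lawentry variance0
  (fun ij => M ij.1 ij.2) mf (fun x => f0 (of_upper x)).
move=> cm; transitivity (\int[P]_w f (of_upper (shift_coordinates D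
    (fun ij => M ij.1 ij.2) (coordinates D entry w))))%E.
  by apply: eq_integral => w _; congr (f _); rewrite of_upper_shift.
rewrite cm; apply: eq_integral => w _; rewrite -[coordinates _ _ w]/(upper w).
rewrite of_upper_entry; congr (_ * (expR _)%:E)%E.
have -> : n%:R / 2 * mx_dot (A w) M - n%:R / 4 * fnorm2 M =
    n%:R / 2 * \sum_i \sum_j (M i j * A w i j - M i j ^+ 2 / 2).
  under eq_bigr do rewrite sumrB -mulr_suml.
  rewrite sumrB -mulr_suml mulrBr; congr (_ - _); last by rewrite /fnorm2; field.
  congr (_ * _); apply: eq_bigr => i _; apply: eq_bigr => j _; exact: mulrC.
rewrite -sum_upper.
  apply: eq_bigr => ij Dij; rewrite mulrBl; congr (_ - _).
  by rewrite invfM mulrA.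
by move=> i j; rewrite symMij (GOE_symmetric goeA w i j).
Qed.

(** Measurability is expressed in the upper-triangular coordinates, where the Cameron-Martin formula
    lives; it passes to preimages under A and under translates of A. *)
Definition mx_measurable (S : set 'M[R]_n) : Prop :=
  measurable [set x : cT | S (of_upper x)].

Lemma measurable_upper : measurable_fun setT upper.
Proof. exact: measurable_to_coordinates. Qed.

Lemma mx_measurable_preimage S : mx_measurable S -> measurable (A @^-1` S).
Proof.
move=> mS; have -> : A @^-1` S = upper @^-1` [set x | S (of_upper x)].
  by apply/seteqP; split => w /=; rewrite of_upper_entry.
by rewrite -[X in measurable X]setTI; exact: measurable_upper.
Qed.

Lemma mx_measurable_shift S M : M^T = M -> mx_measurable S ->
  measurable [set w | S (A w + M)].
Proof.
move=> symM mS.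
have -> : [set w | S (A w + M)] = (fun w => shift_coordinates D
    (fun ij => M ij.1 ij.2) (upper w)) @^-1` [set x | S (of_upper x)].
  by apply/seteqP; split => w /=; rewrite of_upper_shift.
rewrite -[X in measurable X]setTI.
by apply: (measurableT_comp (measurable_shift_coordinates _ _) measurable_upper).
Qed.

(** The densities for M and - M are exp (y - u) and exp (- y - u), with y = n / 2 <A, M> and u = n /
    4 |M|_F^2. Their sum is at least 2 exp (- u) whatever the value of y. *)
Lemma goe_shift_average S M (c : R) : M^T = M -> mx_measurable S ->
  n%:R / 4 * fnorm2 M <= c ->
  ((2 * expR (- c))%:E * P (A @^-1` S) <=
     P [set w | S (A w + M)%R] + P [set w | S (A w - M)%R])%E.
Proof.
move=> symM mS Mc.
have mA := mx_measurable_preimage mS.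
have symN : (- M)^T = - M by rewrite linearN/= symM.
have m1 : measurable_fun setT (fun x : cT => (\1_S (of_upper x))%:E : \bar R).
  have -> : (fun x : cT => (\1_S (of_upper x))%:E : \bar R) =
      (fun x : cT => (\1_[set x : cT | S (of_upper x)] x)%:E).
    by apply/funext => x; rewrite !indicE.
  by apply/measurable_EFinP; exact: measurable_indic.
have S0 N : (0 <= (\1_S N)%:E :> \bar R)%E by rewrite lee_fin.
have shiftE N : N^T = N -> (P [set w | S (A w + N)%R] = \int[P]_w ((\1_S (A w))%:E *
     (expR (n%:R / 2 * mx_dot (A w) N - n%:R / 4 * fnorm2 N))%:E))%E.
  move=> sN; rewrite -(goe_cameron_martin sN m1 S0).
  rewrite -[in LHS](setIT [set w | S (A w + N)]) -(integral_indic _ measurableT).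
    by apply: eq_integral => w _; rewrite !indicE.
  exact: mx_measurable_shift.
have mAij i j : measurable_fun setT (fun w => A w i j) by exact: (GOE_measurable goeA).
have mdot N : measurable_fun setT (fun w => mx_dot (A w) N).
  apply: measurable_sum => i; apply: measurable_sum => j.
  exact: measurable_funM.
have mexp N : measurable_fun setT (fun w =>
    (expR (n%:R / 2 * mx_dot (A w) N - n%:R / 4 * fnorm2 N))%:E).
  apply/measurable_EFinP; apply: measurableT_comp => //.
  by apply: measurable_funB => //; exact: measurable_funM.
have mind : measurable_fun setT (fun w => (\1_S (A w))%:E : \bar R).
  by apply/measurable_EFinP; exact: (measurable_indic mA).
rewrite !shiftE// -ge0_integralD//; [|exact: emeasurable_funM..].
have <- : (\int[P]_w (\1_(A @^-1` S) w)%:E = P (A @^-1` S))%E.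
  by rewrite integral_indic// setIT.
have ce0 : 0 <= 2 * expR (- c) by rewrite mulr_ge0// expR_ge0.
rewrite -ge0_integralZl_EFin//.
apply: ge0_le_integral => //.
- by apply: emeasurable_funM.
- by apply: emeasurable_funD; exact: emeasurable_funM.
move=> w _; rewrite -!EFinM -EFinD lee_fin -mulrDr mulrC.
apply: ler_wpM2l => //.
have dotN : mx_dot (A w) (- M) = - mx_dot (A w) M.
  rewrite /mx_dot -sumrN; apply: eq_bigr => i _; rewrite -sumrN.
  by apply: eq_bigr => j _; rewrite mxE mulrN.
rewrite dotN fnorm2N mulrN !expRD -mulrDl.
have e1 : expR (- c) <= expR (- (n%:R / 4 * fnorm2 M)) by rewrite ler_expR lerN2.
apply: (@le_trans _ _ (2 * expR (- (n%:R / 4 * fnorm2 M)))).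
  by rewrite ler_wpM2l.
rewrite ler_wpM2r ?expR_ge0//.
set y := n%:R / 2 * _.
by have := expR_ge1Dx y; have := expR_ge1Dx (- y); lra.
Qed.

(** The Cameron-Martin densities of two opposite shifts have integral 1, and y^2 <= 2 (exp y + exp
    (- y)) compares the square with their sum. *)
Lemma goe_second_moment M : M^T = M -> fnorm2 M <= 4 ->
  (\int[P]_w (mx_dot (A w) M ^+ 2)%:E <= (16 * expR 1 / n%:R)%:E)%E.
Proof.
(* With N = M / sqrt n, the normalizing factor exp (n / 4 |N|_F^2) is at most e. *)
move=> symM M4; pose t : R := (Num.sqrt n%:R)^-1.
have t2 : t ^+ 2 = n%:R^-1 by rewrite exprVn sqr_sqrtr// ltW.
pose N := t *: M.
have symN : N^T = N by rewrite linearZ/= symM.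
have symNN : (- N)^T = - N by rewrite linearN/= symN.
have mAij i j : measurable_fun setT (fun w => A w i j) by exact: (GOE_measurable goeA).
have mdot N' : measurable_fun setT (fun w => mx_dot (A w) N').
  apply: measurable_sum => i; apply: measurable_sum => j.
  exact: measurable_funM.
have mexp N' : measurable_fun setT (fun w =>
    (expR (n%:R / 2 * mx_dot (A w) N' - n%:R / 4 * fnorm2 N'))%:E).
  apply/measurable_EFinP; apply: measurableT_comp => //.
  by apply: measurable_funB => //; exact: measurable_funM.
have total N' : N'^T = N' -> (\int[P]_w
    (expR (n%:R / 2 * mx_dot (A w) N' - n%:R / 4 * fnorm2 N'))%:E = 1)%E.
  move=> sN; have := goe_cameron_martin (f := fun=> 1%E) sN (measurable_cst _) (fun=> lee01).
  under [in RHS]eq_integral do rewrite mul1e.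
  by move=> <-; rewrite integral_cst// mul1e; exact: probability_setT.
pose g w := ((expR (n%:R / 2 * mx_dot (A w) N - n%:R / 4 * fnorm2 N))%:E +
  (expR (n%:R / 2 * mx_dot (A w) (- N) - n%:R / 4 * fnorm2 (- N)))%:E)%E.
have intg : (\int[P]_w g w = 2%:E)%E.
  by rewrite ge0_integralD// !total// -EFinD.
have -> : (16 * expR 1 / n%:R)%:E = ((8 * expR 1 / n%:R)%:E * \int[P]_w g w)%E.
  by rewrite intg -EFinM; congr EFin; ring.
have mg : measurable_fun setT g by exact: emeasurable_funD.
have g0 w : (0 <= g w)%E by rewrite adde_ge0// lee_fin expR_ge0.
have k0 : 0 <= 8 * expR 1 / n%:R :> R by rewrite divr_ge0 ?ltW// mulr_ge0// expR_ge0.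
rewrite -ge0_integralZl_EFin//.
apply: ge0_le_integral => //.
- by move=> w _; rewrite lee_fin; exact: sqr_ge0.
- by apply/measurable_EFinP; apply: measurable_funX.
- by apply: emeasurable_funM.
move=> w _; rewrite /g -EFinD -EFinM lee_fin.
have dotN : mx_dot (A w) (- N) = - mx_dot (A w) N.
  rewrite /mx_dot -sumrN; apply: eq_bigr => i _; rewrite -sumrN.
  by apply: eq_bigr => j _; rewrite mxE mulrN.
have dotZ : mx_dot (A w) N = t * mx_dot (A w) M.
  rewrite /mx_dot mulr_sumr; apply: eq_bigr => i _; rewrite mulr_sumr.
  by apply: eq_bigr => j _; rewrite mxE mulrCA.
rewrite dotN fnorm2N mulrN !expRD -mulrDl dotZ.
set z := mx_dot _ _; set y := n%:R / 2 * _.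
have yz : z ^+ 2 = 4 / n%:R * y ^+ 2.
  rewrite /y !exprMn t2; field; rewrite gt_eqF//.
have ey : y ^+ 2 <= 2 * (expR y + expR (- y)).
  have [y0|/ltW y0] := leP 0 y.
    have := expR_ge1Dxn 1 y0; have := expR_ge0 (- y).
    by rewrite !factS fact0 muln1; lra.
  have y0' : 0 <= - y by rewrite oppr_ge0.
  have := expR_ge1Dxn 1 y0'; have := expR_ge0 y.
  by rewrite !factS fact0 muln1 sqrrN; lra.
have c1 : 1 <= expR 1 * expR (- (n%:R / 4 * fnorm2 N)).
  rewrite -expRD -[leLHS]expR0 ler_expR subr_ge0 fnorm2Z t2 [_ * (_ * fnorm2 M)]mulrA.
  have -> : n%:R / 4 / n%:R = 4^-1 :> R by field; rewrite gt_eqF.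
  by rewrite mulrC ler_pdivrMr// mul1r.
have s0 : 0 <= expR y + expR (- y) by rewrite addr_ge0// expR_ge0.
rewrite yz.
apply: (@le_trans _ _ (4 / n%:R * (2 * (expR y + expR (- y))))).
  by rewrite ler_wpM2l// divr_ge0// ltW.
have -> : 8 * expR 1 / n%:R * ((expR y + expR (- y)) * expR (- (n%:R / 4 * fnorm2 N))) =
   4 / n%:R * (2 * (expR y + expR (- y))) * (expR 1 * expR (- (n%:R / 4 * fnorm2 N))).
  by field; rewrite gt_eqF.
by rewrite ler_peMr// !mulr_ge0// invr_ge0 ltW.
Qed.

(* Translating A by the L multiples 3 k s of M (|k| <= L) moves l by as much and
   fixes C, so the translates of the event are disjoint, and they are likely. *)
Lemma goe_small_ball (C : set 'M[R]_n) (l : 'M[R]_n -> R) M (L : nat) (s : R) :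
  M^T = M -> fnorm2 M <= 2 -> mx_measurable C ->
  (forall a b, mx_measurable [set N | C N /\ a < l N < b]) ->
  (forall N t, C (N + t *: M) <-> C N) ->
  (forall N t, l (N + t *: M) = l N + t) ->
  s = (3 * L%:R * Num.sqrt n%:R)^-1 ->
  (L%:R%:E * P [set w | C (A w) /\ (`|l (A w)| < s)%R] <= 2%:E * P (A @^-1` C))%E.
Proof.
move=> symM M2 mC mCl CM lM sE.
have [->|L0] := posnP L; first by rewrite mul0e mule_ge0// measure_ge0.
have LR : 0 < L%:R :> R by rewrite ltr0n.
have sn0 : 0 < Num.sqrt n%:R :> R by rewrite sqrtr_gt0.
have s0 : 0 < s by rewrite sE invr_gt0 !mulr_gt0.
pose S := [set N | C N /\ - s < l N < s].
have SE : [set w | C (A w) /\ (`|l (A w)| < s)%R] = A @^-1` S.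
  by apply/seteqP; split => w /=; rewrite ltr_norml.
rewrite SE; set pS := P (A @^-1` S).
(* For a fixed sign [sg] the centres of the windows are 3 s apart and each window has width 2 s. *)
pose E (sg : R) (k : nat) := [set w | S (A w + (sg * (3 * k.+1%:R * s)) *: M)].
have mE sg k : measurable (E sg k).
  by apply: mx_measurable_shift; [rewrite linearZ/= symM|exact: mCl].
have EE sg k w : E sg k w <-> C (A w) /\
    - s < l (A w) + sg * (3 * k.+1%:R * s) < s.
  by rewrite /E /S /= lM; split=> -[/CM].
have sumE sg : sg ^+ 2 = 1 -> (\sum_(k < L) P (E sg k) <= P (A @^-1` C))%E.
  move=> sg1.
  rewrite -(@measure_semi_additive_ord_I _ _ _ P (E sg) L)//; last 2 first.
  - apply/trivIsetP => i j _ _ ij; rewrite -subset0 => w [/EE[_ /andP[h1 h2]]].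
    move=> /EE[_ /andP[]]; set a := l _ + _ in h1 h2; set b := l _ + _ => h3 h4.
    have ab : (a - b) ^+ 2 = 9 * s ^+ 2 * (i.+1%:R - j.+1%:R) ^+ 2.
      transitivity (sg ^+ 2 * (9 * s ^+ 2 * (i.+1%:R - j.+1%:R) ^+ 2)).
        by rewrite /a /b; ring.
      by rewrite sg1 mul1r.
    have ij1 : 1 <= (i.+1%:R - j.+1%:R : R) ^+ 2.
      case: (ltngtP i j) ij => // ij _.
        have : (i.+1%:R + 1 : R) <= j.+1%:R by rewrite natr1 ler_nat ltnS.
        by nra.
      have : (j.+1%:R + 1 : R) <= i.+1%:R by rewrite natr1 ler_nat ltnS.
      by nra.
    have := ler_wpM2l (sqr_ge0 s) ij1; nra.
  - by apply: bigsetU_measurable => k _.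
  apply: le_measure; rewrite ?inE.
  - by apply: bigsetU_measurable => k _.
  - exact: mx_measurable_preimage.
  - by move=> w; rewrite -bigcup_mkord => -[k _ /EE[]].
have avg (k : 'I_L) : (pS <= P (E 1%R k) + P (E (- 1)%R k))%E.
  pose N := (3 * k.+1%:R * s) *: M.
  have symN : N^T = N by rewrite linearZ/= symM.
  (* The choice of s gives 3 (k + 1) s <= 1 / sqrt n. The resulting factor 2 exp (- 1 / 2) in
     [goe_shift_average] is at least 1. *)
  have Nc : n%:R / 4 * fnorm2 N <= 2^-1.
    have t0 : 0 <= 3 * k.+1%:R * s by rewrite !mulr_ge0// ltW.
    have : 3 * k.+1%:R * s <= (Num.sqrt n%:R)^-1.
      have -> : 3 * k.+1%:R * s = k.+1%:R / L%:R * (Num.sqrt n%:R)^-1.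
        by rewrite sE; field; rewrite !gt_eqF.
      by rewrite ler_piMl ?invr_ge0 ?(ltW sn0)// ler_pdivrMr// mul1r ler_nat.
    move=> /(lerXn2r 2); rewrite !nnegrE t0 invr_ge0 (ltW sn0) => /(_ isT isT).
    rewrite exprVn sqr_sqrtr ?(ltW nR0)// => t2.
    rewrite fnorm2Z.
    have : (3 * k.+1%:R * s) ^+ 2 * fnorm2 M <= n%:R^-1 * 2.
      by rewrite ler_pM ?sqr_ge0 ?fnorm2_ge0.
    move=> h; apply: (@le_trans _ _ (n%:R / 4 * (n%:R^-1 * 2))).
      by rewrite ler_wpM2l// divr_ge0// ltW.
    have -> : n%:R / 4 * (n%:R^-1 * 2) = 2^-1 :> R by field; rewrite gt_eqF.
    by [].
  have := goe_shift_average symN (mCl (- s) s) Nc.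
  have -> : [set w | S (A w + N)] = E 1 k by rewrite /E mul1r.
  have -> : [set w | S (A w - N)] = E (- 1) k by rewrite /E mulN1r scaleNr.
  apply: le_trans; rewrite -[leLHS]mul1e lee_wpmul2r ?measure_ge0// lee_fin.
  by have := expR_ge1Dx (- 2^-1 : R); lra.
have : (\sum_(k < L) pS <= \sum_(k < L) (P (E 1%R k) + P (E (- 1)%R k)))%E.
  by apply: lee_sum => k _; exact: avg.
rewrite big_split/= => h.
have -> : (L%:R%:E * pS = \sum_(k < L) pS)%E.
  by rewrite sumr_const card_ord mule_natl.
apply: (le_trans h).
have -> : (2%:E * P (A @^-1` C) = P (A @^-1` C) + P (A @^-1` C))%E.
  by rewrite mule_natl mule2n.
by apply: leeD; apply: sumE; rewrite ?sqrrN expr1n.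
Qed.

Section selection.
Variables (c : 'M[R]_n -> nat) (l : nat -> 'M[R]_n -> R) (M : nat -> 'M[R]_n).
Variables (L : nat) (s : R).
Hypothesis symM : forall k, (M k)^T = M k.
Hypothesis M2 : forall k, fnorm2 (M k) <= 2.
Hypothesis mc : forall k, mx_measurable [set N | c N = k].
Hypothesis ml : forall k a b, mx_measurable [set N | a < l k N < b].
Hypothesis cM : forall k N t, c (N + t *: M k) = k <-> c N = k.
Hypothesis lM : forall k N t, l k (N + t *: M k) = l k N + t.
Hypothesis sE : s = (3 * L%:R * Num.sqrt n%:R)^-1.

Let B k := [set w | c (A w) = k /\ `|l k (A w)| < s].

Let mcl k a b : mx_measurable [set N | c N = k /\ a < l k N < b].
Proof. exact: (measurableI _ _ (mc k) (ml k a b)). Qed.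

Let mB k : measurable (B k).
Proof.
have -> : B k = A @^-1` [set N | c N = k /\ - s < l k N < s].
  by apply/seteqP; split => w /=; rewrite /B/= ltr_norml.
exact: mx_measurable_preimage.
Qed.

Let BE : [set w | `|l (c (A w)) (A w)| < s] = \bigcup_k B k.
Proof.
by apply/seteqP; split => [w /= lw|w [k _ [<-]]]; first exists (c (A w)).
Qed.

Lemma measurable_selected_small_ball : measurable [set w | `|l (c (A w)) (A w)| < s].
Proof. by rewrite BE; apply: bigcupT_measurable. Qed.

(** The label c cuts the space into countably many cells. In the cell of label k the form and the
    direction are fixed, and translation along M k preserves the cell, so [goe_small_ball] applies
    with this cell as C. The cell probabilities add up to at most 1. *)
Lemma goe_selected_small_ball :
  (L%:R%:E * P [set w | (`|l (c (A w)) (A w)| < s)%R] <= 2%:E)%E.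
Proof.
pose C k := [set w | c (A w) = k].
have mC k : measurable (C k) by exact: (mx_measurable_preimage (mc k)).
have disj (F : nat -> set T) : (forall k, F k `<=` C k) -> trivIset setT F.
  move=> FC; apply/trivIsetP => i j _ _ ij; rewrite -subset0 => w [/FC Ci /FC Cj].
  by move: ij; rewrite -Ci -Cj eqxx.
rewrite BE measure_semi_bigcup//; last 2 first.
- by apply: disj => k w [].
- exact: bigcupT_measurable.
rewrite -nneseriesZl//.
apply: (@le_trans _ _ (\sum_(k <oo) 2%:E * P (C k))%E).
  apply: lee_nneseries => k _.
    by rewrite mule_ge0// measure_ge0.
  exact: (goe_small_ball (symM k) (M2 k) (mc k) (mcl k) (cM k) (lM k) sE).
rewrite nneseriesZl//.
rewrite -measure_semi_bigcup//; last 2 first.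
- by apply: disj => k.
- exact: bigcupT_measurable.
rewrite -[leRHS]mule1 lee_wpmul2l//; apply: probability_le1.
exact: bigcupT_measurable.
Qed.

End selection.

(** Each form is small with probability at most 2 / L, and Markov's inequality bounds the number of
    small ones. *)
Lemma goe_few_selected_small_balls N (c : 'M[R]_n -> nat) (l : 'I_N -> nat -> 'M[R]_n -> R)
    (M : 'I_N -> nat -> 'M[R]_n) (L : nat) (s a : R) : (0 < L)%N -> 0 < a ->
  (forall i k, (M i k)^T = M i k) -> (forall i k, fnorm2 (M i k) <= 2) ->
  (forall k, mx_measurable [set N | c N = k]) ->
  (forall i k u v, mx_measurable [set N | u < l i k N < v]) ->
  (forall i k N t, c (N + t *: M i k) = k <-> c N = k) ->
  (forall i k N t, l i k (N + t *: M i k) = l i k N + t) ->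
  s = (3 * L%:R * Num.sqrt n%:R)^-1 ->
  let E := [set w | a <= #|[pred i | `|l i (c (A w)) (A w)| < s]|%:R] in
  measurable E /\ (P E <= (2 * N%:R / (L%:R * a))%:E)%E.
Proof.
move=> L0 a0 symM M2 mc ml cM lM sE E.
have LR : 0 < L%:R :> R by rewrite ltr0n.
pose B i := [set w | `|l i (c (A w)) (A w)| < s].
have mB i : measurable (B i).
  exact: (measurable_selected_small_ball s mc (ml i)).
have BL i : (P (B i) <= (2 / L%:R)%:E)%E.
  have := goe_selected_small_ball (symM i) (M2 i) mc (ml i) (cM i) (lM i) sE.
  by rewrite EFinM -lee_pdivlMl// muleC.
have EE : E = [set w | a <= \sum_i \1_(B i) w].
  have sumE w : #|[pred i | `|l i (c (A w)) (A w)| < s]|%:R = \sum_i \1_(B i) w :> R.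
    rewrite -sum1_card natr_sum big_mkcond/=; apply: eq_bigr => i _.
    rewrite indicE inE; case: ifPn => h; first by rewrite mem_set.
    by rewrite memNset//; exact/negP.
  by apply/seteqP; split=> w; have := sumE w; rewrite /E /mkset => ->.
split.
  rewrite EE -[X in measurable X]setTI.
  have -> : [set w | a <= \sum_i \1_(B i) w] =
      (fun w => \sum_i \1_(B i) w) @^-1` `[a, +oo[%classic.
    by apply/seteqP; split => w /=; rewrite in_itv/= andbT.
  have mS : measurable_fun setT (fun w => \sum_i \1_(B i) w : R).
    by apply: measurable_sum => i; exact: measurable_indic.
  exact: mS.
have := markov_count (ltW a0) mB BL; rewrite -EE => h.
rewrite -(@lee_pmul2l _ a%:E)// (le_trans h)// lee_fin.
by rewrite le_eqVlt; apply/orP; left; apply/eqP; field; rewrite !gt_eqF.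
Qed.

End goe.

(** * Rounding to countably many values *)

Section rank_two_moments.
Context {d} {T : measurableType d} {R : realType} (P : probability T R).
Context {n : nat} (A : T -> 'M[R]_n).
Hypothesis n0 : (0 < n)%N.
Hypothesis goeA : GOE P A.

Lemma rank_two_sym (a b : 'cV[R]_n) : (a *m b^T + b *m a^T)^T = a *m b^T + b *m a^T.
Proof. by rewrite linearD/= !trmx_mul !trmxK addrC. Qed.

Lemma rank_one_fnorm2 p q (a : 'cV[R]_p) (b : 'cV[R]_q) :
  a^T *m a = 1%:M -> b^T *m b = 1%:M -> fnorm2 (a *m b^T) = 1.
Proof.
move=> aa bb; rewrite fnorm2_isoml// -fnorm2_tr trmxK -fnorm2_tr fnorm2E trmxK bb.
by rewrite mxtrace1.
Qed.

Lemma rank_two_fnorm2 (a b : 'cV[R]_n) : a^T *m a = 1%:M -> b^T *m b = 1%:M ->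
  b^T *m a = 0 -> fnorm2 (a *m b^T + b *m a^T) = 2.
Proof.
move=> aa bb ba; have ab : a^T *m b = 0 by rewrite -[LHS]trmxK trmx_mul trmxK ba trmx0.
rewrite fnorm2E rank_two_sym mulmxDl !mulmxDr.
rewrite -!mulmxA [b^T *m (a *m _)]mulmxA ba mul0mx mulmx0 add0r.
rewrite [b^T *m (b *m _)]mulmxA bb mul1mx [a^T *m (a *m _)]mulmxA aa mul1mx.
rewrite [a^T *m (b *m _)]mulmxA ab mul0mx mulmx0 addr0 mxtraceD.
by rewrite mxtrace_mulC aa mxtrace_mulC bb !mxtrace1.
Qed.

Lemma mx_dot_rank_two (N : 'M[R]_n) (a b : 'cV[R]_n) : N^T = N ->
  mx_dot N (a *m b^T + b *m a^T) = 2 * (a^T *m N *m b) 0 0.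
Proof.
move=> symN.
have dotE (M : 'M[R]_n) : mx_dot N M = \tr (N *m M).
  rewrite /mx_dot /mxtrace exchange_big/=; apply: eq_bigr => i _.
  by rewrite mxE; apply: eq_bigr => j _; rewrite -{1}symN mxE.
have traceE (x y : 'cV[R]_n) : \tr (N *m (x *m y^T)) = (y^T *m N *m x) 0 0.
  by rewrite mulmxA mxtrace_mulC mulmxA /mxtrace big_ord1.
rewrite dotE mulmxDr mxtraceD !traceE mulr2n mulrDl mul1r; congr (_ + _).
have -> : b^T *m N *m a = (a^T *m N *m b)^T by rewrite !trmx_mul trmxK symN mulmxA.
by rewrite mxE.
Qed.

Lemma measurable_bilinear (a b : 'cV[R]_n) :
  measurable_fun setT (fun w => (a^T *m A w *m b) 0 0).
Proof.
have -> : (fun w => (a^T *m A w *m b) 0 0) =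
    (fun w => \sum_j (\sum_i a i 0 * A w i j) * b j 0).
  apply/funext => w; rewrite mxE; apply: eq_bigr => j _; congr (_ * _).
  by rewrite mxE; apply: eq_bigr => i _; rewrite mxE.
apply: measurable_sum => j; apply: measurable_funM => //.
apply: measurable_sum => i; apply: measurable_funM => //.
exact: (GOE_measurable goeA).
Qed.

(** The symmetric test matrix a b^T + b a^T has inner product 2 a^T A b with A, and squared norm at
    most 4 even when a and b are not orthogonal. *)
Lemma goe_bilinear_moment (a b : 'cV[R]_n) :
  a^T *m a = 1%:M -> b^T *m b = 1%:M ->
  (\int[P]_w ((a^T *m A w *m b) 0 0 ^+ 2)%:E <= (4 * expR 1 / n%:R)%:E)%E.
Proof.
move=> aa bb.
have M4 : fnorm2 (a *m b^T + b *m a^T) <= 4.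
  by rewrite (le_trans (fnorm2D_le _ _))// !rank_one_fnorm2//; lra.
have := goe_second_moment n0 goeA (rank_two_sym a b) M4.
have symA w : (A w)^T = A w by apply/matrixP => i j; rewrite mxE (GOE_symmetric goeA).
under eq_integral do rewrite mx_dot_rank_two// exprMn EFinM.
have mA : measurable_fun setT (fun w => ((a^T *m A w *m b) 0 0 ^+ 2)%:E : \bar R).
  by apply/measurable_EFinP; apply: measurable_funX; exact: measurable_bilinear.
rewrite ge0_integralZl_EFin//; last by move=> w _; rewrite lee_fin sqr_ge0.
have -> : (16 * expR 1 / n%:R)%:E = ((2 ^+ 2)%:E * (4 * expR 1 / n%:R)%:E)%E :> \bar R.
  by rewrite -EFinM; congr EFin; ring.
by rewrite lee_pmul2l.
Qed.

Lemma goe_sum_moment (I : finType) (a b : I -> 'cV[R]_n) (c : R) :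
  (forall i, (a i)^T *m a i = 1%:M) -> (forall i, (b i)^T *m b i = 1%:M) -> 0 < c ->
  (P [set w | c <= \sum_i ((a i)^T *m A w *m b i) 0 0 ^+ 2]%R <=
    (#|I|%:R * (4 * expR 1 / n%:R) / c)%:E)%E.
Proof.
move=> aa bb c0.
have mf i : measurable_fun setT (fun w => (((a i)^T *m A w *m b i) 0 0 ^+ 2)%:E : \bar R).
  by apply/measurable_EFinP; apply: measurable_funX; exact: measurable_bilinear.
rewrite mulrC EFinM lee_pdivlMl//.
have -> : [set w | c <= \sum_i ((a i)^T *m A w *m b i) 0 0 ^+ 2]%R =
    [set w | (c%:E <= \sum_i (((a i)^T *m A w *m b i) 0 0 ^+ 2)%:E)%E].
  by apply/seteqP; split => w /=; rewrite sumEFin lee_fin.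
apply: markov_ge0; first exact: ltW.
- exact: emeasurable_sum.
- by move=> w; apply: sume_ge0 => i _; rewrite lee_fin sqr_ge0.
rewrite ge0_integral_sum//; last by move=> i w _; rewrite lee_fin sqr_ge0.
rewrite mulr_natl -sumr_const -sumEFin.
by apply: lee_sum => i _; exact: goe_bilinear_moment.
Qed.

End rank_two_moments.

Section rounding.
Context {R : realType} (eta : R).
Hypothesis eta0 : 0 < eta.

Definition round_mx p q (N : 'M[R]_(p, q)) : 'M[int]_(p, q) :=
  \matrix_(i, j) Num.floor (N i j / eta).

Definition grid_mx p q (K : 'M[int]_(p, q)) : 'M[R]_(p, q) :=
  \matrix_(i, j) ((K i j)%:~R * eta).

Lemma fnorm2_round_mx p q (N : 'M[R]_(p, q)) :
  fnorm2 (N - grid_mx (round_mx N)) <= (p * q)%:R * eta ^+ 2.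
Proof.
apply: (@le_trans _ _ (\sum_(i < p) \sum_(j < q) eta ^+ 2)); last first.
  under eq_bigr do rewrite sumr_const card_ord; rewrite sumr_const card_ord -mulrnA.
  by rewrite mulr_natl mulnC.
apply: ler_sum => i _; apply: ler_sum => j _; rewrite !mxE.
set y := N i j; have yE : y = y / eta * eta by rewrite divfK// gt_eqF.
have /andP[h1 h2] := floor_itv (y / eta).
have h3 : 0 <= y - (Num.floor (y / eta))%:~R * eta.
  by rewrite {1}yE -mulrBl mulr_ge0 ?subr_ge0// (ltW eta0).
have h4 : y - (Num.floor (y / eta))%:~R * eta <= eta.
  rewrite {1}yE -mulrBl -[leRHS]mul1r ler_wpM2r ?(ltW eta0)// lerBlDr.
  by rewrite addrC -[X in _ + X]/(1%:~R) -intrD ltW.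
by rewrite lerXn2r// nnegrE (ltW eta0).
Qed.

Lemma round_mx_sym p (N : 'M[R]_p) : N^T = N ->
  (grid_mx (round_mx N))^T = grid_mx (round_mx N).
Proof.
by move=> symN; apply/matrixP => i j; rewrite !mxE -{2}symN mxE.
Qed.

End rounding.

Section cells.
Context {R : realType} {n : nat}.

Local Notation D := [pred ij : 'I_n * 'I_n | (ij.1 <= ij.2)%N].
Local Notation cT := (g_sigma_algebraType (@coordinate_rectangles R _ D)).

Lemma measurable_bilinear_of_upper p q (U : 'M[R]_(p, n)) (V : 'M[R]_(n, q)) i j :
  measurable_fun setT (fun x : cT => (U *m of_upper x *m V) i j).
Proof.
have -> : (fun x : cT => (U *m of_upper x *m V) i j) =
    (fun x : cT => \sum_k (\sum_l U i l * of_upper x l k) * V k j).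
  by apply/funext => x; rewrite mxE; apply: eq_bigr => k _; rewrite mxE.
apply: measurable_sum => k; apply: measurable_funM => //.
apply: measurable_sum => l; apply: measurable_funM => //.
exact: measurable_of_upper.
Qed.

Lemma mx_measurable_itv p q (U : 'M[R]_(p, n)) (V : 'M[R]_(n, q)) i j a b :
  mx_measurable [set N : 'M[R]_n | a < (U *m N *m V) i j < b].
Proof.
rewrite /mx_measurable.
have -> : [set x : cT | a < (U *m of_upper x *m V) i j < b] =
    (fun x : cT => (U *m of_upper x *m V) i j) @^-1` `]a, b[%classic.
  by apply/seteqP; split => x /=; rewrite in_itv.
by rewrite -[X in measurable X]setTI; exact: measurable_bilinear_of_upper.
Qed.

Lemma mx_measurable_round eta p q (U : 'M[R]_(p, n)) (V : 'M[R]_(n, q)) K :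
  0 < eta -> mx_measurable [set N : 'M[R]_n | round_mx eta (U *m N *m V) = K].
Proof.
move=> eta0; rewrite /mx_measurable.
have -> : [set x : cT | round_mx eta (U *m of_upper x *m V) = K] =
    \bigcap_(ij in [set: 'I_p * 'I_q])
      ((fun x : cT => (U *m of_upper x *m V) ij.1 ij.2) @^-1`
        `[(K ij.1 ij.2)%:~R * eta, (K ij.1 ij.2 + 1)%:~R * eta[%classic).
  apply/seteqP; split => [x /= <- [i j] _ /=|x /= xK].
    rewrite in_itv/= [round_mx _ _ _ _]mxE -ler_pdivlMr// -ltr_pdivrMr//.
    exact: floor_itv.
  apply/matrixP => i j; rewrite [LHS]mxE; apply: floor_def.
  by have := xK (i, j) I; rewrite /= in_itv/= -ler_pdivlMr// -ltr_pdivrMr.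
apply: fin_bigcap_measurable => // ij _.
by rewrite -[X in measurable X]setTI; exact: measurable_bilinear_of_upper.
Qed.

(** The labels in [goe_selected_small_ball] are natural numbers, so a value of a countable type is
    replaced by its code. A number that codes nothing has an empty cell. *)
Lemma mx_measurable_pickle (C : countType) (r : 'M[R]_n -> C) :
  (forall k, mx_measurable [set N | r N = k]) ->
  forall k, mx_measurable [set N | pickle (r N) = k].
Proof.
move=> mr k; case E : (@pickle_inv C k) => [y|].
  have -> : [set N | pickle (r N) = k] = [set N | r N = y]; last exact: mr.
  apply/seteqP; split => N /=; first by move=> Nk; move: E; rewrite -Nk pickleK_inv => -[].
  by move=> ->; have := @pickle_invK C k; rewrite /oapp E.
have -> : [set N | pickle (r N) = k] = set0; last exact: measurable0.
by apply/seteqP; split => N //= Nk; move: E; rewrite -Nk pickleK_inv.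
Qed.

End cells.

(** * Rigidity of the GOE commutator *)

Section rigidity.
Context {R : realType}.

(** In the application s = 1 / (3 l^2 sqrt n) and K = 4 l, and kappa makes 64 K kappa equal to (s /
    2 * s)^2. Rounding contributes at most 4 + 1, which with the initial 4 gives 9; the commutator
    coefficients 144^2 and 576 add up to less than 150^2. *)
Lemma rigidity_arithmetic (l n m q s kappa c x1 x2 : R) :
  1 <= l -> 1 <= n -> 0 <= m -> m <= n -> 0 <= c -> x1 <= n / l -> x2 <= n / l ->
  q = (9 * l ^+ 4 * n)^-1 -> s ^+ 2 = q -> kappa = q ^+ 2 / (32 ^+ 2 * l) ->
  4 + 4 * x1 + 4 * x2 + 16 * (4 * l) / (s / 2 * s) ^+ 2 * (c + 16 * kappa)
    + 8 * m / (s / 2) ^+ 2 * (2 * c + 8 * kappa) <=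
  9 + 8 * (n / l) + 150 ^+ 2 * l ^+ 9 * n ^+ 2 * c.
Proof.
move=> l1 n1 m0 mn c0 x1n x2n qE sq kE.
have l0 : 0 < l by exact: lt_le_trans l1.
have n0 : 0 < n by exact: lt_le_trans n1.
have -> : (s / 2 * s) ^+ 2 = q ^+ 2 / 4 by rewrite -sq; field.
have -> : (s / 2) ^+ 2 = q / 4 by rewrite -sq; field.
have q0 : 0 < q by rewrite qE invr_gt0 !mulr_gt0// exprn_gt0.
have -> : 16 * (4 * l) / (q ^+ 2 / 4) * (c + 16 * kappa) =
    144 ^+ 2 * (l ^+ 9 * n ^+ 2 * c) + 4.
  by rewrite kE qE; field; rewrite !gt_eqF.
have -> : 8 * m / (q / 4) * (2 * c + 8 * kappa) =
    576 * (l ^+ 4 * n * m * c) + m / (36 * l ^+ 5 * n).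
  by rewrite kE qE; field; rewrite !gt_eqF.
have h1 : l ^+ 4 * n * m * c <= l ^+ 9 * n ^+ 2 * c.
  rewrite ler_wpM2r// -mulrA; apply: ler_pM.
  - by rewrite exprn_ge0// ltW.
  - by rewrite mulr_ge0// ltW.
  - by rewrite ler_weXn2l.
  - by rewrite expr2 ler_wpM2l// ltW.
have h2 : m / (36 * l ^+ 5 * n) <= 1.
  rewrite ler_pdivrMr ?mul1r ?mulr_gt0// ?exprn_gt0//; apply: (le_trans mn).
  rewrite ler_peMl ?(ltW n0)//.
  by have := exprn_ege1 5 l1; lra.
have h3 : 0 <= l ^+ 9 * n ^+ 2 * c by rewrite !mulr_ge0 ?exprn_ge0 ?(ltW l0) ?(ltW n0).
lra.
Qed.

(** The eigenbasis is chosen as a function of an integer matrix; composed with rounding it takes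
    countably many values, which settles measurability. *)
Lemma diagonalization_selection (p : nat) (eta : R) :
  exists (O : 'M[int]_p -> 'M[R]_p) (mu : 'M[int]_p -> 'rV[R]_p),
    forall K, [/\ O K *m (O K)^T = 1%:M, (O K)^T *m O K = 1%:M &
      (grid_mx eta K)^T = grid_mx eta K ->
      O K *m grid_mx eta K = diag_mx (mu K) *m O K].
Proof.
suff /choice[F HF] : forall K : 'M[int]_p, exists Od : 'M[R]_p * 'rV[R]_p,
    [/\ Od.1 *m Od.1^T = 1%:M, Od.1^T *m Od.1 = 1%:M &
      (grid_mx eta K)^T = grid_mx eta K ->
      Od.1 *m grid_mx eta K = diag_mx Od.2 *m Od.1].
  by exists (fun K => (F K).1), (fun K => (F K).2).
move=> K; have [symK|nsymK] := eqVneq (grid_mx eta K)^T (grid_mx eta K).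
  by have [ O [mu [? ? ?]]] := real_spectral symK; exists (O, mu).
(* A default for non-symmetric matrices, where the eigen-equation is not claimed. *)
exists (1%:M, 0); split; rewrite /= ?trmx1 ?mulmx1// => symK.
by rewrite symK eqxx in nsymK.
Qed.

Lemma frame_selection (p : nat) (eta : R) :
  exists (f : 'cV[int]_p.+1 -> 'cV[R]_p.+1) (xi : 'cV[int]_p.+1 -> R)
    (V : 'cV[int]_p.+1 -> 'M[R]_(p, p.+1)),
    forall K, [/\ (f K)^T *m f K = 1%:M, grid_mx eta K = xi K *: f K,
      V K *m (V K)^T = 1%:M, (V K)^T *m V K = 1%:M - f K *m (f K)^T &
      V K *m f K = 0].
Proof.
suff /choice[F HF] : forall K : 'cV[int]_p.+1, exists t : ('cV[R]_p.+1 * R) * 'M[R]_(p, p.+1),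
    [/\ t.1.1^T *m t.1.1 = 1%:M, grid_mx eta K = t.1.2 *: t.1.1,
      t.2 *m t.2^T = 1%:M, t.2^T *m t.2 = 1%:M - t.1.1 *m t.1.1^T & t.2 *m t.1.1 = 0].
  by exists (fun K => (F K).1.1), (fun K => (F K).1.2), (fun K => (F K).2).
move=> K; suff [f [xi [ff fK]]] : exists (f : 'cV[R]_p.+1) (xi : R),
    f^T *m f = 1%:M /\ grid_mx eta K = xi *: f.
  have [V [VV VV' Vf]] := orthogonal_complement ff.
  by exists (f, xi, V).
set g := grid_mx eta K.
have gg : g^T *m g = (fnorm2 g)%:M.
  apply/matrixP => i j; rewrite !ord1 -fnorm2_tr fnorm2E trmxK [RHS]mxE eqxx mulr1n.
  by rewrite /mxtrace big_ord1.
(* If g = 0, any unit vector serves as f, with xi = 0. *)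
have [g0|] := eqVneq (fnorm2 g) 0.
  exists (delta_mx 0 0), 0; split.
    by apply/matrixP => i j; rewrite trmx_delta mul_delta_mx !ord1 !mxE.
  apply/matrixP => i j; rewrite scale0r [RHS]mxE; apply/eqP.
  by rewrite -sqrf_eq0 eq_le sqr_ge0 andbT -g0 sqr_le_fnorm2.
move=> gn0; have g0 : 0 < fnorm2 g by rewrite lt_def gn0 fnorm2_ge0.
have s0 : Num.sqrt (fnorm2 g) != 0 by rewrite sqrtr_eq0 -ltNge.
exists ((Num.sqrt (fnorm2 g))^-1 *: g), (Num.sqrt (fnorm2 g)); split.
  rewrite [(_ *: g)^T]linearZ/= -scalemxAl -scalemxAr scalerA gg scale_scalar_mx.
  by rewrite -invfM -expr2 sqr_sqrtr ?mulVf// ltW.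
by rewrite scalerA divff// scale1r.
Qed.

Lemma row_unit p (O : 'M[R]_p) i : O *m O^T = 1%:M ->
  row i O *m (row i O)^T = 1%:M.
Proof.
move=> OO; apply/matrixP => x y; rewrite !ord1; have /matrixP/(_ i i) := OO.
rewrite !mxE !eqxx !mulr1n => <-.
by apply: eq_bigr => k _; rewrite !mxE.
Qed.

Lemma mul_row_unit p (O : 'M[R]_p) i : O *m O^T = 1%:M ->
  (O *m (row i O)^T) i 0 = 1.
Proof.
move=> OO; have /matrixP/(_ i i) := OO; rewrite !mxE eqxx mulr1n => <-.
by apply: eq_bigr => k _; rewrite !mxE.
Qed.

Section probability.
Context {d} {T : measurableType d} (P : probability T R).
Context {m : nat} (A : T -> 'M[R]_m.+2) (e : 'cV[R]_m.+2) (L : nat).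
Hypothesis goeA : GOE P A.
Hypothesis ee : e^T *m e = 1%:M.
Hypothesis L0 : (0 < L)%N.

(** G excludes three events: many small <w_i, X>, many small <z_j, A' f>, and a large |A e|. It is
    chosen before W, which allows a W that depends on A and on the noise. On G the conclusion is
    [compression_bound]. *)
Lemma goe_rigidity : exists G : set T,
  [/\ measurable G, (P (~` G) <= ((4 + 4 * expR 1) / L%:R)%:E)%E &
    forall w, G w -> forall W : 'M[R]_m.+2, W *m e = 0 -> e^T *m W = 0 ->
      (forall p (M : 'M[R]_(m.+2, p)), fnorm2 (W *m M) <= 4 * fnorm2 M) ->
      (forall p (M : 'M[R]_(m.+2, p)), fnorm2 (W^T *m M) <= 4 * fnorm2 M) ->
      fnorm2 W <= 9 + 8 * (m.+2%:R / L%:R) +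
        150 ^+ 2 * L%:R ^+ 9 * m.+2%:R ^+ 2 * fnorm2 (A w *m W - W *m A w)].
Proof.
have LR : 0 < L%:R :> R by rewrite ltr0n.
have nR : 0 < m.+2%:R :> R by rewrite ltr0n.
have symA w : (A w)^T = A w.
  by apply/matrixP => i j; rewrite mxE (GOE_symmetric goeA).
have [U [UU UU' Ue]] := orthogonal_complement ee.
have eU : e^T *m U^T = 0 by rewrite -trmx_mul Ue trmx0.
(* The small-ball bound is used with L^2 in place of L: each form is small with probability at most
   2 / L^2, so at least n / L of them are small with probability at most 2 / L. *)
pose s : R := (3 * (L ^ 2)%:R * Num.sqrt m.+2%:R)^-1.
have s0 : 0 < s by rewrite invr_gt0 !mulr_gt0 ?sqrtr_gt0// ltr0n expn_gt0 L0.
pose q : R := (9 * L%:R ^+ 4 * m.+2%:R)^-1.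
have sq : s ^+ 2 = q.
  by rewrite /s exprVn !exprMn sqr_sqrtr ?ltW// natrX -exprM /q; congr (_ * _ * _)^-1; ring.
have q0 : 0 < q by rewrite -sq exprn_gt0.
pose kappa : R := q ^+ 2 / (32 ^+ 2 * L%:R).
have kappa0 : 0 < kappa by rewrite divr_gt0 ?mulr_gt0 ?exprn_gt0.
(* With this mesh, rounding a matrix with at most m + 2 rows and columns costs at most kappa in
   squared norm. *)
pose eta : R := Num.sqrt kappa / m.+2%:R.
have eta0 : 0 < eta by rewrite divr_gt0// sqrtr_gt0.
have round_le p r (N : 'M[R]_(p, r)) : (p <= m.+2)%N -> (r <= m.+2)%N ->
    fnorm2 (N - grid_mx eta (round_mx eta N)) <= kappa.
  move=> pm rm; apply: le_trans (fnorm2_round_mx eta0 _) _.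
  rewrite /eta exprMn sqr_sqrtr ?(ltW kappa0)// exprVn mulrCA ler_piMr ?(ltW kappa0)//.
  by rewrite ler_pdivrMr ?exprn_gt0// mul1r -natrX ler_nat expnS expn1 leq_mul.
have [ O [mu HO]] := diagonalization_selection m.+1 eta.
have [f [xi [V HV]]] := frame_selection m eta.
have [ O2 [nu HO2]] := diagonalization_selection m eta.
pose a : R := m.+2%:R / L%:R.
have a0 : 0 < a by rewrite divr_gt0.
pose r1 (N : 'M[R]_m.+2) := round_mx eta (U *m N *m U^T).
pose rX (N : 'M[R]_m.+2) := round_mx eta (U *m N *m e).
(* The rounded X is part of the label because it determines f and V, hence the second
   compression. *)
pose r2 (N : 'M[R]_m.+2) :=
  (rX N, round_mx eta (V (rX N) *m (U *m N *m U^T) *m (V (rX N))^T)).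
(* The default values concern only numbers that are not codes. *)
pose dec1 k : 'M[int]_m.+1 := odflt 0 (unpickle k).
pose dec2 k : 'cV[int]_m.+1 * 'M[int]_m := odflt (0, 0) (unpickle k).
pose l1 (i : 'I_m.+1) k (N : 'M[R]_m.+2) := (O (dec1 k) *m U *m N *m e) i 0.
pose l2 (j : 'I_m) k (N : 'M[R]_m.+2) :=
  (O2 (dec2 k).2 *m V (dec2 k).1 *m U *m N *m (U^T *m f (dec2 k).1)) j 0.
have pb : (0 < L ^ 2)%N by rewrite expn_gt0 L0.
pose sym2 (x y : 'cV[R]_m.+2) := x *m y^T + y *m x^T.
pose o1 i k := U^T *m (row i (O (dec1 k)))^T.
pose o2 j k := U^T *m ((V (dec2 k).1)^T *m (row j (O2 (dec2 k).2))^T).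
(* The directions e w^T + w e^T and f z^T + z f^T, with w, f and z lifted by U^T. *)
pose M1 i k := sym2 (o1 i k) e.
pose M2 j k := sym2 (U^T *m f (dec2 k).1) (o2 j k).
have OO k : O (dec1 k) *m (O (dec1 k))^T = 1%:M by have [] := HO (dec1 k).
have OO2 k : O2 (dec2 k).2 *m (O2 (dec2 k).2)^T = 1%:M by have [] := HO2 (dec2 k).2.
have UUV p (x : 'M[R]_(m.+1, p)) : U *m (U^T *m x) = x by rewrite mulmxA UU mul1mx.
have entryE p (x y : 'cV[R]_p) t i : (x + t *: y) i 0 = x i 0 + t * y i 0.
  by rewrite !mxE.
have entryB p (x y : 'cV[R]_p) i : (x - y) i 0 = x i 0 - y i 0 by rewrite !mxE.
have [] := @goe_few_selected_small_balls _ T R P m.+2 A isT goeA m.+1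
  (pickle \o r1) l1 M1 (L ^ 2) s a pb a0.
- by move=> i k; exact: rank_two_sym.
- move=> i k; rewrite /M1 /sym2 rank_two_fnorm2//.
    by rewrite /o1 trmx_mul !trmxK -mulmxA UUV row_unit.
  by rewrite /o1 mulmxA eU mul0mx.
- by apply: mx_measurable_pickle => K; exact: mx_measurable_round.
- by move=> i k u v; exact: (mx_measurable_itv (O (dec1 k) *m U) e).
(* Since U e = 0, the shift leaves U N U^T unchanged, hence also the label. *)
- move=> i k N t; rewrite /comp; suff -> : r1 (N + t *: M1 i k) = r1 N by [].
  rewrite /r1 mulmxDr mulmxDl -scalemxAr -scalemxAl; congr round_mx.
  rewrite /M1 /sym2 mulmxDr mulmxDl !mulmxA Ue !mul0mx -!mulmxA eU !mulmx0.
  by rewrite !addr0 scaler0 addr0.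
- move=> i k N t; rewrite /l1 mulmxDr mulmxDl -scalemxAr -scalemxAl entryE.
  congr (_ + _); rewrite -[RHS]mulr1; congr (_ * _).
  have M1e : M1 i k *m e = o1 i k.
    rewrite /M1 /sym2 mulmxDl -!mulmxA ee mulmx1 /o1 trmx_mul !trmxK -mulmxA Ue.
    by rewrite !mulmx0 addr0.
  rewrite -!mulmxA M1e /o1 UUV.
  exact: mul_row_unit.
- by [].
move=> mE1 PE1.
have [] := @goe_few_selected_small_balls _ T R P m.+2 A isT goeA m
  (pickle \o r2) l2 M2 (L ^ 2) s a pb a0.
- by move=> j k; exact: rank_two_sym.
- move=> j k; have [ff _ VV _ Vf] := HV (dec2 k).1.
  rewrite /M2 /sym2 rank_two_fnorm2//.
  + by rewrite trmx_mul trmxK -mulmxA UUV.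
  + rewrite /o2 trmx_mul trmxK -mulmxA UUV trmx_mul !trmxK -mulmxA.
    by rewrite [V _ *m (_ *m _)]mulmxA VV mul1mx row_unit.
  + by rewrite /o2 trmx_mul trmxK -mulmxA UUV trmx_mul !trmxK -mulmxA Vf mulmx0.
- apply: mx_measurable_pickle => -[K1 K2].
  have -> : [set N | r2 N = (K1, K2)] = [set N | rX N = K1] `&`
      [set N | round_mx eta ((V K1 *m U) *m N *m (U^T *m (V K1)^T)) = K2].
    apply/seteqP; split => N /=; rewrite /r2 !mulmxA; first by move=> [-> <-].
    by move=> [-> <-].
  apply: measurableI; first exact: mx_measurable_round.
  exact: mx_measurable_round.
- by move=> j k u v; exact: mx_measurable_itv.
(* The shift kills e, so X is unchanged. When the rounded X is the one coded by k, V f = 0 also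
   keeps the second compression unchanged; either side of the equivalence puts the proof in this
   case. *)
- move=> j k N t; have [ff _ VV _ Vf] := HV (dec2 k).1.
  have Me : M2 j k *m e = 0.
    rewrite /M2 /sym2 mulmxDl -!mulmxA /o2 !trmx_mul !trmxK -!mulmxA Ue !mulmx0.
    by rewrite addr0.
  have rXE : rX (N + t *: M2 j k) = rX N.
    rewrite /rX mulmxDr mulmxDl -scalemxAr -scalemxAl -[U *m M2 j k *m e]mulmxA Me.
    by rewrite mulmx0 scaler0 addr0.
  have key : rX N = (dec2 k).1 -> r2 (N + t *: M2 j k) = r2 N.
    rewrite /r2 rXE => ->; congr (_, round_mx _ _).
    rewrite mulmxDr -scalemxAr [_ *m U^T]mulmxDl -scalemxAl.
    rewrite [V _ *m (_ + _)]mulmxDr -scalemxAr mulmxDl -scalemxAl.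
    set z := (V (dec2 k).1)^T *m (row j (O2 (dec2 k).2))^T.
    have -> : U *m M2 j k *m U^T = f (dec2 k).1 *m z^T + z *m (f (dec2 k).1)^T.
      rewrite /M2 /sym2 mulmxDr mulmxDl /o2 -/z !trmx_mul !trmxK -!mulmxA !UUV UU.
      by rewrite !mulmx1.
    have fV : (f (dec2 k).1)^T *m (V (dec2 k).1)^T = 0 by rewrite -trmx_mul Vf trmx0.
    rewrite mulmxDr mulmxDl !mulmxA Vf !mul0mx -!mulmxA fV !mulmx0.
    by rewrite !addr0 scaler0 addr0.
  have decP N' : pickle (r2 N') = k -> rX N' = (dec2 k).1.
    by move=> <-; rewrite /dec2 pickleK.
  rewrite /comp; split=> h; have := decP _ h; last by move=> /key ->.
  by rewrite rXE => /key <-.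
- move=> j k N t; have [ff _ VV _ Vf] := HV (dec2 k).1.
  rewrite /l2 mulmxDr mulmxDl -scalemxAr -scalemxAl entryE.
  congr (_ + _); rewrite -[RHS]mulr1; congr (_ * _).
  have M2f : M2 j k *m (U^T *m f (dec2 k).1) = o2 j k.
    rewrite /M2 /sym2 mulmxDl -!mulmxA /o2 !trmx_mul !trmxK -!mulmxA !UUV ff Vf.
    by rewrite !mulmx0 add0r mulmx1.
  rewrite -!mulmxA M2f /o2 UUV [V _ *m _]mulmxA VV mul1mx.
  exact: mul_row_unit.
- by [].
move=> mE2 PE2.
set E1 := [set w | _] in mE1 PE1; set E2 := [set w | _] in mE2 PE2.
pose E3 := [set w | L%:R <= fnorm2 (A w *m e)].
have PE3 : measurable E3 /\ (P E3 <= (4 * expR 1 / L%:R)%:E)%E.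
  pose b k : 'cV[R]_m.+2 := delta_mx k 0.
  have bb k : (b k)^T *m b k = 1%:M.
    by apply/matrixP => i j; rewrite trmx_delta mul_delta_mx !ord1 !mxE.
  have E3E : E3 = [set w | L%:R <= \sum_k ((b k)^T *m A w *m e) 0 0 ^+ 2].
    have sumE w : fnorm2 (A w *m e) = \sum_k ((b k)^T *m A w *m e) 0 0 ^+ 2.
      apply: eq_bigr => k _; rewrite big_ord1; congr (_ ^+ 2).
      by rewrite -mulmxA trmx_delta -rowE [RHS]mxE.
    by apply/seteqP; split => w; have := sumE w; rewrite /E3 /mkset => ->.
  split; rewrite E3E.
    rewrite -[X in measurable X]setTI.
    have -> : [set w | L%:R <= \sum_k ((b k)^T *m A w *m e) 0 0 ^+ 2] =
        (fun w => \sum_k ((b k)^T *m A w *m e) 0 0 ^+ 2) @^-1` `[L%:R, +oo[%classic.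
      by apply/seteqP; split => w /=; rewrite in_itv/= andbT.
    have mS : measurable_fun setT (fun w => \sum_k ((b k)^T *m A w *m e) 0 0 ^+ 2).
      by apply: measurable_sum => k; apply: measurable_funX; exact: (measurable_bilinear goeA).
    exact: mS.
  apply: le_trans (@goe_sum_moment _ T R P m.+2 A isT goeA _ b (fun=> e) L%:R bb (fun=> ee) LR) _.
  rewrite lee_fin card_ord le_eqVlt; apply/orP; left; apply/eqP.
  by field; rewrite !gt_eqF.
case: PE3 => mE3 PE3.
have few N : (N <= m.+2)%N -> 2 * N%:R / ((L ^ 2)%:R * a) <= 2 / L%:R :> R.
  move=> Nm; have -> : 2 * N%:R / ((L ^ 2)%:R * a) = 2 / L%:R * (N%:R / m.+2%:R) :> R.
    by rewrite /a natrX; field; rewrite !gt_eqF.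
  by rewrite ler_piMr ?divr_ge0 ?(ltW LR)// ler_pdivrMr// mul1r ler_nat.
exists (~` (E1 `|` E2 `|` E3)); split.
- by apply: measurableC; do 2 apply: measurableU => //.
- rewrite setCK; apply: (@le_trans _ _ (P (E1 `|` E2) + P E3)%E).
    by apply: measureU2 => //; exact: measurableU.
  apply: (@le_trans _ _ (P E1 + P E2 + P E3)%E).
    by rewrite leeD2r//; apply: measureU2.
  have -> : (4 + 4 * expR 1) / L%:R = 2 / L%:R + 2 / L%:R + 4 * expR 1 / L%:R :> R.
    by rewrite -!mulrDl; congr (_ / _); ring.
  rewrite !EFinD; apply: leeD => //; apply: leeD.
    by apply: (le_trans PE1); rewrite lee_fin few.
  by apply: (le_trans PE2); rewrite lee_fin few// leqW.
move=> w /= /not_orP[/not_orP[/negP nE1 /negP nE2] /negP nE3] W We eW W4 WT4.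
have l1' : 1 <= L%:R :> R by rewrite ler1n.
have n1 : 1 <= m.+2%:R :> R by rewrite ler1n.
move: nE1 nE2 nE3; rewrite -!ltNge => nE1 nE2 nE3.
set k1 := (pickle \o r1) (A w) in nE1; set k2 := (pickle \o r2) (A w) in nE2.
have dec1E : dec1 k1 = r1 (A w) by rewrite /dec1 /k1/= pickleK.
have dec2E : dec2 k2 = r2 (A w) by rewrite /dec2 /k2/= pickleK.
have [ff gX VV VV' Vf] := HV (rX (A w)).
have [ O1O O1O' O1A] := HO (r1 (A w)).
have [ O2O O2O' O2A] := HO2 (r2 (A w)).2.
set A2 := grid_mx eta (r2 (A w)).2 in O2A *.
have symA1 : (U *m A w *m U^T)^T = U *m A w *m U^T.
  by rewrite !trmx_mul trmxK symA mulmxA.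
have symA2 : A2^T = A2.
  by apply: round_mx_sym; rewrite !trmx_mul !trmxK symA !mulmxA.
set I : pred 'I_m.+1 := fun i => ~~ (`|l1 i k1 (A w)| < s).
set J : pred 'I_m := fun j => ~~ (`|l2 j k2 (A w)| < s).
have l0 := ltW LR.
have q1 : q <= 1.
  by rewrite invf_le1 ?mulr_gt0 ?exprn_gt0//; have := exprn_ege1 4 l1'; nra.
have kappa1 : kappa <= s ^+ 2 / 4 /\ kappa <= L%:R.
  have kq : kappa <= q / 4.
    rewrite /kappa ler_pdivrMr ?mulr_gt0 ?exprn_gt0//.
    by have := q0; have := l1'; nra.
  by split; [rewrite sq|move: kq l1' q1; lra].
case: kappa1 => kappas kappaL.
have Xr : fnorm2 (U *m A w *m e - grid_mx eta (rX (A w))) <= kappa by exact: round_le.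
(* Here 2 L comes from the bound on |A e|^2, and rounding adds 2 kappa <= 2 L. *)
have XK : fnorm2 (grid_mx eta (rX (A w))) <= 4 * L%:R.
  have -> : grid_mx eta (rX (A w)) = U *m A w *m e -
      (U *m A w *m e - grid_mx eta (rX (A w))) by rewrite opprB addrC subrK.
  apply: (le_trans (fnorm2B_le _ _)); rewrite -mulmxA.
  have := fnorm2_coisoml_le (A w *m e) UU; rewrite mulmxA; move: Xr nE3; lra.
have bI : #|predC I|%:R <= m.+2%:R / L%:R :> R.
  apply: ltW; apply: le_lt_trans nE1; rewrite ler_nat; apply: subset_leq_card.
  by apply/fintype.subsetP => i; rewrite !inE negbK.
have bJ : #|predC J|%:R <= m.+2%:R / L%:R :> R.
  apply: ltW; apply: le_lt_trans nE2; rewrite ler_nat; apply: subset_leq_card.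
  by apply/fintype.subsetP => i; rewrite !inE negbK.
(* The small-ball event concerns the exact vector U A e. Rounding moves each coordinate by at most s
   / 2, as kappa <= s^2 / 4, which leaves s / 2. *)
have HI i : I i -> s / 2 <= `|(O (r1 (A w)) *m grid_mx eta (rX (A w))) i 0|.
  rewrite /I /l1 dec1E -leNgt -!mulmxA => sI.
  set x := (O _ *m (U *m _)) i 0 in sI; set y := _ i 0.
  have xy : (x - y) ^+ 2 <= (s / 2) ^+ 2.
    have -> : x - y = (O (r1 (A w)) *m (U *m A w *m e - grid_mx eta (rX (A w)))) i 0.
      by rewrite mulmxBr entryB -!mulmxA.
    apply: le_trans (sqr_le_fnorm2 _ _ _) _; rewrite fnorm2_isoml//.
    by have -> : (s / 2) ^+ 2 = s ^+ 2 / 4; [by field|exact: le_trans Xr _].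
  have : `|x - y| <= s / 2.
    by rewrite -(@ler_pXn2r _ 2) ?nnegrE// ?real_normK ?num_real// divr_ge0// ltW.
  have := ler_distD y x 0; rewrite !subr0.
  lra.
have HJ j : J j ->
    s <= `|(O2 (r2 (A w)).2 *m V (rX (A w)) *m (U *m A w *m U^T) *m f (rX (A w))) j 0|.
  by rewrite /J /l2 dec2E -leNgt !mulmxA.
have K64 : 64 * (4 * L%:R) * kappa <= (s / 2 * s) ^+ 2.
  have -> : (s / 2 * s) ^+ 2 = q ^+ 2 / 4 by rewrite -sq; field.
  have -> : 64 * (4 * L%:R) * kappa = q ^+ 2 / 4.
    by rewrite /kappa; field; rewrite gt_eqF.
  exact: lexx.
apply: le_trans (compression_bound UU UU' ee (symA w) We eW W4 WT4 O1O O1O'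
  (O1A (round_mx_sym _ symA1)) _ Xr gX ff XK VV VV' O2O O2O' (O2A symA2) symA2
  _ _ HI s0 HJ K64) _.
- exact: round_le.
- by apply: round_le; rewrite !leqW.
- by rewrite divr_gt0.
apply: (@rigidity_arithmetic _ _ _ q) => //; first by rewrite ler_nat !leqW.
exact: fnorm2_ge0.
Qed.

End probability.

End rigidity.

(** * From rigidity to few errors *)

Section few_errors.
Context {R : realType} {d} {T : measurableType d} (P : probability T R).

(** Each of the n^2 entries has second moment at most 4 e / n, so |Z|_F^2 has mean at most 4 e n. *)
Lemma goe_fnorm2_tail n (Z : T -> 'M[R]_n) (L : nat) : (0 < n)%N -> (0 < L)%N ->
  GOE P Z -> let E := [set w | n%:R * L%:R <= fnorm2 (Z w)] in
  measurable E /\ (P E <= (4 * expR 1 / L%:R)%:E)%E.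
Proof.
move=> n0 L0 goeZ E.
have nR : 0 < n%:R :> R by rewrite ltr0n.
have LR : 0 < L%:R :> R by rewrite ltr0n.
pose b (k : 'I_n) : 'cV[R]_n := delta_mx k 0.
have bb k : (b k)^T *m b k = 1%:M.
  by apply/matrixP => i j; rewrite trmx_delta mul_delta_mx !ord1 !mxE.
pose S w := \sum_(ij : 'I_n * 'I_n) ((b ij.1)^T *m Z w *m b ij.2) 0 0 ^+ 2.
have EE : E = [set w | n%:R * L%:R <= S w].
  have SE w : fnorm2 (Z w) = S w.
    rewrite /fnorm2 pair_bigA/=; apply: eq_bigr => -[i j] _ /=; congr (_ ^+ 2).
    by rewrite trmx_delta -rowE -colE [RHS]mxE [RHS]mxE.
  by apply/seteqP; split => w; have := SE w; rewrite /E /mkset => ->.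
split; rewrite EE.
  rewrite -[X in measurable X]setTI.
  have -> : [set w | n%:R * L%:R <= S w] = S @^-1` `[n%:R * L%:R, +oo[%classic.
    by apply/seteqP; split => w /=; rewrite in_itv/= andbT.
  have mS : measurable_fun setT S.
    apply: measurable_sum => ij; apply: measurable_funX.
    exact: (measurable_bilinear goeZ).
  exact: mS.
apply: le_trans (@goe_sum_moment _ T R P n Z n0 goeZ _ (fun ij => b ij.1)
  (fun ij => b ij.2) _ (fun ij => bb ij.1) (fun ij => bb ij.2) (mulr_gt0 nR LR)) _.
rewrite lee_fin card_prod card_ord natrM le_eqVlt; apply/orP; left; apply/eqP.
by field; rewrite !gt_eqF.
Qed.

(** y stands for n^eps. The event F is fixed before the minimizer and pihat, so the bound covers
    arbitrary, possibly nonmeasurable, choices of both. *)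
Lemma wigner_few_errors m (sigma y : R) (pi : {perm 'I_m.+2})
    (A B : T -> 'M[R]_m.+2) (L : nat) :
  gaussian_wigner P sigma pi A B -> (0 < L)%N -> L%:R ^+ 11 <= y ->
  0 <= sigma <= (m.+2%:R * y)^-1 ->
  exists F : set T, [/\ measurable F, (P (~` F) <= ((4 + 8 * expR 1) / L%:R)%:E)%E &
    forall w, F w -> forall X pihat,
      argmin (birkhoff m.+2)
        (fun X : 'M[R]_m.+2 => frobenius_norm (A w *m X - X *m B w) ^+ 2) X ->
      (forall i, argmax [set: 'I_m.+2] (fun j => X i j) (pihat i)) ->
      (\sum_(i < m.+2) (pihat i != pi i : nat))%N%:R <=
        36 + 700 ^+ 2 * (m.+2%:R / L%:R) :> R].
Proof.
move=> [Z [goeA goeZ _ BE]] L0 Ly /andP[sigma0 sigmay].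
have LR : 0 < L%:R :> R by rewrite ltr0n.
have nR : 0 < m.+2%:R :> R by rewrite ltr0n.
pose e : 'cV[R]_m.+2 := const_mx (Num.sqrt m.+2%:R)^-1.
have ee : e^T *m e = 1%:M.
  apply/matrixP => i j; rewrite !ord1 !mxE eqxx.
  under eq_bigr do rewrite !mxE -invfM -expr2 sqr_sqrtr ?ltW//.
  by rewrite sumr_const card_ord -[_ *+ _]mulr_natr mulVf// gt_eqF.
have [G [mG PG HG]] := goe_rigidity goeA ee L0.
have [] := @goe_fnorm2_tail m.+2 Z L isT L0 goeZ; set E := [set w | _] => mE PE.
exists (G `&` ~` E); split.
- by apply: measurableI => //; exact: measurableC.
- rewrite setCI setCK; apply: (@le_trans _ _ (P (~` G) + P E)%E).
    by apply: measureU2 => //; exact: measurableC.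
  have -> : (4 + 8 * expR 1) / L%:R = (4 + 4 * expR 1) / L%:R + 4 * expR 1 / L%:R :> R.
    by rewrite -mulrDl; congr (_ / _); ring.
  by rewrite EFinD leeD.
move=> w [Gw /negP]; rewrite -ltNge => fZ X pihat minX maxX.
have [bX _] := minX.
apply: (le_trans (errors_le_fnorm2 pi bX maxX)).
set Y := \matrix_(i, j) X i (pi j).
have bY : birkhoff m.+2 Y := birkhoff_colperm pi bX.
set W := 1%:M - Y.
have We : W *m e = 0.
  have [_ Yr _] := bY; apply/colP => i; rewrite /W mulmxBl mul1mx !mxE.
  under eq_bigr do rewrite [e _ _]mxE.
  by rewrite -mulr_suml Yr mul1r subrr.
have eW : e^T *m W = 0.
  have [_ _ Yc] := bY; apply/rowP => j; rewrite /W mulmxBr mulmx1 !mxE.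
  under eq_bigr do rewrite ![_^T _ _]mxE [e _ _]mxE.
  by rewrite -mulr_sumr Yc mulr1 subrr.
have W4 p (M : 'M[R]_(m.+2, p)) : fnorm2 (W *m M) <= 4 * fnorm2 M.
  exact: one_sub_birkhoff_contraction.
have WT4 p (M : 'M[R]_(m.+2, p)) : fnorm2 (W^T *m M) <= 4 * fnorm2 M.
  rewrite /W linearB/= trmx1; apply: one_sub_birkhoff_contraction.
  exact: birkhoff_tr.
have := HG w Gw W We eW W4 WT4.
have := minimizer_commutator (BE w) minX (erefl Y); rewrite -/W.
set c := fnorm2 (A w *m W - W *m A w) => cZ fW.
have n1 : 1 <= m.+2%:R :> R by rewrite ler1n.
have l1 : 1 <= L%:R :> R by rewrite ler1n.
have c0 : 0 <= c by exact: fnorm2_ge0.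
have z0 := fnorm2_ge0 (Z w).
move: fZ cZ fW; set z := fnorm2 (Z w) in z0 *; set f := fnorm2 W.
move: m.+2%:R L%:R nR LR n1 l1 Ly sigmay => n l n0 l0 n1 l1 ly sy fZ cZ fW.
have y0 : 0 < y by apply: lt_le_trans ly; rewrite exprn_gt0.
have s2 : sigma ^+ 2 <= (n ^+ 2 * y ^+ 2)^-1.
  by rewrite -exprMn -exprVn lerXn2r// nnegrE invr_ge0 mulr_ge0// ltW.
(* As c <= 4 sigma^2 n L <= 4 L / (n y^2), the left-hand side is at most 4 n L^10 / y^2. One more
   factor L is spent to gain 1 / L, whence the exponent 11. *)
have key : l ^+ 9 * n ^+ 2 * c <= 4 * (n / l).
  have h1 : c <= 4 * (n ^+ 2 * y ^+ 2)^-1 * (n * l).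
    apply: (le_trans cZ); have s4 : 4 * sigma ^+ 2 <= 4 * (n ^+ 2 * y ^+ 2)^-1.
      by move: s2; set u := _^-1; lra.
    by rewrite ler_pM ?(ltW fZ) ?mulr_ge0 ?sqr_ge0.
  apply: (@le_trans _ _ (l ^+ 9 * n ^+ 2 * (4 * (n ^+ 2 * y ^+ 2)^-1 * (n * l)))).
    by rewrite ler_wpM2l// mulr_ge0 ?exprn_ge0 ?(ltW l0) ?(ltW n0).
  have -> : l ^+ 9 * n ^+ 2 * (4 * (n ^+ 2 * y ^+ 2)^-1 * (n * l)) =
      4 * (n / l) * (l ^+ 11 / y ^+ 2) by field; rewrite !gt_eqF.
  rewrite ler_piMr ?mulr_ge0 ?invr_ge0 ?(ltW n0) ?(ltW l0)//.
  rewrite ler_pdivrMr ?exprn_gt0// mul1r; apply: (le_trans ly).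
  rewrite expr2 ler_peMl ?(ltW y0)//; apply: le_trans ly; exact: exprn_ege1.
have nl0 : 0 <= n / l by rewrite divr_ge0 ?(ltW n0) ?(ltW l0).
have uE : 150 ^+ 2 * l ^+ 9 * n ^+ 2 * c = 150 ^+ 2 * (l ^+ 9 * n ^+ 2 * c) by ring.
rewrite uE in fW; move: key fW; set u := l ^+ 9 * n ^+ 2 * c.
(* The constants come from 36 = 4 * 9 and 4 * (8 + 4 * 150^2) <= 700^2. *)
by set t := n / l in nl0 *; lra.
Qed.

End few_errors.

(** * The growth rate of L *)

Section rates.
Context {R : realType} (delta : R).
Hypothesis delta0 : 0 < delta.

(** This is the parameter L. It tends to infinity, so n / L = o(n) and failure probabilities of
    order 1 / L vanish, while a small delta keeps its powers below n^eps. *)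
Definition rate (n : nat) : nat := Num.truncn (n%:R `^ delta).

Lemma rate_gt0 n : (0 < n)%N -> (0 < rate n)%N.
Proof.
move=> n0; rewrite /rate truncn_gt0.
have one : 1 `^ delta = 1 :> R by rewrite powR1.
by rewrite -[leLHS]one ge0_ler_powR ?nnegrE ?ler1n ?(ltW delta0).
Qed.

Lemma rate_le n : (rate n)%:R <= n%:R `^ delta.
Proof. by rewrite truncn_le// powR_ge0. Qed.

Lemma cvg_rate_inv : (rate n)%:R^-1 @[n --> \oo] --> (0 : R).
Proof.
apply/cvgr0Pnorm_le => /= e e0; near=> n.
pose K : R := e^-1 + 1.
have K0 : 0 <= K by rewrite addr_ge0 ?invr_ge0// ltW.
have Kn : K <= n%:R `^ delta.
  have -> : K = (K `^ delta^-1) `^ delta by rewrite -powRrM mulVf ?gt_eqF// powRr1.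
  by rewrite ge0_ler_powR ?nnegrE ?powR_ge0 ?(ltW delta0)//; near: n; exact: nbhs_infty_ger.
have en : e^-1 <= (rate n)%:R.
  have := truncnS_gt (n%:R `^ delta); rewrite -/(rate n) -natr1.
  by move: Kn; rewrite /K; lra.
have rn0 : 0 < (rate n)%:R :> R by apply: lt_le_trans en; rewrite invr_gt0.
by rewrite ger0_norm ?invr_ge0// invf_ple// posrE.
Unshelve. all: by end_near. Qed.

Lemma rate_littleo (a c : R) : 0 <= a -> 0 <= c ->
  (fun n => a + c * (n%:R / (rate n)%:R)) =o_\oo (fun n => n%:R : R).
Proof.
move=> a0 c0; apply/eqoP => e e0.
(* The added 1 keeps the denominator positive when c = 0. *)
have c1 : 0 < c + 1 by rewrite ltr_wpDl.
have e1 : 0 < e / (2 * (c + 1)) by rewrite divr_gt0// mulr_gt0.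
near=> n.
have n0 : 0 < n%:R :> R by rewrite ltr0n; near: n; exact: nbhs_infty_gt.
rewrite [`|n%:R : R|]gtr0_norm// ger0_norm; last first.
  by rewrite addr_ge0// mulr_ge0// divr_ge0// ltW.
have ha : a <= e / 2 * n%:R.
  rewrite mulrC -ler_pdivrMr ?divr_gt0//.
  by near: n; exact: nbhs_infty_ger.
have hL : c * (rate n)%:R^-1 <= e / 2.
  have : (rate n)%:R^-1 <= e / (2 * (c + 1)).
    rewrite -[leLHS]ger0_norm ?invr_ge0//; near: n.
    by have /cvgr0Pnorm_le := cvg_rate_inv; apply.
  move=> /(ler_wpM2l c0) /le_trans; apply.
  rewrite mulrCA ler_wpM2l ?(ltW e0)// invfM mulrCA ler_piMr// ler_pdivrMr// mul1r.
  by rewrite lerDl.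
have : c * (n%:R / (rate n)%:R) <= e / 2 * n%:R.
  by rewrite mulrCA mulrC ler_wpM2r ?(ltW n0).
lra.
Unshelve. all: by end_near. Qed.

End rates.

Theorem corollary2 (R : realType) (eps : R) (heps : 0 < eps)
    (d : nat -> measure_display) (T : forall n, measurableType (d n))
    (P : forall n, probability (T n) R)
    (sigma : nat -> R)
    (hsigma01 : forall n, 0 <= sigma n <= 1)
    (hsigma : forall n, (0 < n)%N -> sigma n <= n%:R `^ (- 1 - eps))
    (pistar : forall n, {perm 'I_n})
    (A B : forall n, T n -> 'M[R]_n)
    (hAB : forall n, gaussian_wigner (P n) (sigma n) (pistar n) (A n) (B n))
    (Xstar : forall n, T n -> 'M[R]_n)
    (hXstar : forall n (w : T n),
      argmin (birkhoff n)
        (fun X : 'M[R]_n => frobenius_norm (A n w *m X - X *m B n w) ^+ 2)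
        (Xstar n w))
    (pihat : forall n, T n -> 'I_n -> 'I_n)
    (hpihat : forall n (w : T n) (i : 'I_n),
      argmax [set: 'I_n] (fun j => Xstar n w i j) (pihat n w i)) :
  exists r : nat -> R,
    r =o_\oo (fun n => n%:R : R) /\
    with_high_probability P (fun n =>
      [set w : T n |
        (\sum_(i < n) (pihat n w i != pistar n i : nat))%N%:R <= r n]).

Proof.
(* The exponent 11 required by [wigner_few_errors] becomes L^11 <= n^eps. *)
pose delta : R := eps / 11.
have delta0 : 0 < delta by rewrite divr_gt0.
pose L := rate delta.
pose C0 : R := 4 + 8 * expR 1.
have C00 : 0 <= C0 by rewrite addr_ge0 ?mulr_ge0 ?ler0n ?expR_ge0.
pose r (n : nat) : R := 36 + 700 ^+ 2 * (n%:R / (L n)%:R).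
have cvgL := cvg_rate_inv delta0.
exists r; split.
  by apply: rate_littleo; rewrite ?sqr_ge0.
pose E n := [set w : T n |
  (\sum_(i < n) (pihat n w i != pistar n i : nat))%N%:R <= r n].
have exF n : exists F : set (T n), [/\ measurable F, F `<=` E n &
    (1 < n)%N -> (P n (~` F) <= (C0 / (L n)%:R)%:E)%E].
  (* For n <= 1 the empty event is enough, because only the limit matters. *)
  case: n => [|[|m]].
  - by exists set0; split=> //; exact: measurable0.
  - by exists set0; split=> //; exact: measurable0.
  have n0 : 0 < m.+2%:R :> R by rewrite ltr0n.
  have [||F [mF PF HF]] := @wigner_few_errors R _ _ (P m.+2) m (sigma m.+2)
    (m.+2%:R `^ eps) (pistar m.+2) (A m.+2) (B m.+2) (L m.+2) (hAB m.+2)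
    (@rate_gt0 R delta delta0 m.+2 isT).
  - apply: (@le_trans _ _ ((m.+2%:R `^ delta) ^+ 11)).
      by rewrite lerXn2r ?nnegrE ?powR_ge0// rate_le.
    by rewrite -powR_mulrn ?powR_ge0// -powRrM /delta divfK.
  - have /andP[-> _] := hsigma01 m.+2; rewrite andTb.
    apply: le_trans (hsigma m.+2 isT) _; rewrite powRB ?(gt_eqF n0) ?implybT//.
    rewrite powRN powRr1 ?(ltW n0)//.
    by rewrite invfM.
  exists F; split=> [//|w Fw|_]; last exact: PF.
  exact: (HF w Fw _ _ (hXstar _ w) (hpihat _ w)).
pose F n := projT1 (cid (exF n)).
have HF n : [/\ measurable (F n), F n `<=` E n &
    (1 < n)%N -> (P n (~` (F n)) <= (C0 / (L n)%:R)%:E)%E] := projT2 (cid (exF n)).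
exists F; split=> [n|n|]; [by case: (HF n)|by case: (HF n)|].
apply: (@squeeze_cvge _ _ _ _ (fun n => (1 - C0 * (L n)%:R^-1)%:E) _ (fun=> 1%E)).
- near=> n; have [mF _ PF] := HF n; rewrite probability_le1// andbT.
  have n1 : (1 < n)%N by near: n; exact: nbhs_infty_gt.
  have := PF n1; rewrite probability_setC// EFinB.
  rewrite leeBlDr ?fin_num_measure// => h.
  by rewrite leeBlDr// addeC.
- have -> : (fun n => (1 - C0 * (L n)%:R^-1)%:E) = EFin \o (fun n => 1 - C0 * (L n)%:R^-1) by [].
  apply/fine_cvgP; split; first by near=> n.
  rewrite -[X in _ --> X]/(1 : R) -[X in _ --> X](subr0 (1 : R)).
  apply: cvgB; first exact: cvg_cst.
  by rewrite -(mulr0 C0); apply: cvgMr; exact: cvgL.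
- exact: cvg_cst.
Unshelve. all: by end_near. Qed.
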